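(* Let $\mathcal E=\{n\ge 5 : W_n\text{ is geodesic Leech}\}$ (with $n$ an integer). Then $$\{5,6,\ldots,13\}\subseteq\mathcal E\subseteq\{5,6,\ldots,40\}.$$
   Context: Graphs are finite, simple, undirected and connected. A geodesic of a graph $G$ is a shortest path between two distinct vertices; a path and its reverse are regarded as the same, but distinct shortest paths with the same endpoints are counted separately. Let $t_{gp}(G)$ be the number of geodesics of $G$. For an edge labeling $f:E(G)\to\{1,2,3,\ldots\}$, the weight of a path is the sum of the labels of its edges. The labeling $f$ is a geodesic Leech labeling if the multiset of the weights of all geodesics of $G$ is exactly $\{1,2,\ldots,t_{gp}(G)\}$, each value occurring once. A graph is geodesic Leech if it admits a geodesic Leech labeling. $W_n$ denotes the wheel on $n$ vertices: a hub joined to every vertex of a cycle of length $n-1$. *)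

(* Defs.v *)
From mathcomp Require Import all_boot.

Set Implicit Arguments.
Unset Strict Implicit.
Unset Printing Implicit Defensive.

Record sgraph := SGraph {
  vertex :> finType;
  adj : rel vertex;
  adj_sym : symmetric adj;
  adj_irr : irreflexive adj;
  adj_connected : forall x y : vertex, connect adj x y }.

Section Geodesics.
Variable G : sgraph.
Implicit Types (x : G) (p : seq G) (f : {set G} -> nat).

(* An edge is the two-element set of its ends. *)
Definition edges : {set {set G}} :=
  [set [set u.1; u.2] | u : G * G & adj u.1 u.2].

(* As in path.v, the pair (x, p) stands for the vertex sequence x :: p;
   [path] alone allows repeated vertices, hence [uniq]. *)
Definition is_path x p : bool := path (@adj G) x p && uniq (x :: p).

Definition is_geodesic x p : bool :=
  [&& is_path x p, x != last x p
    & [forall k : 'I_(size p), [forall q : k.-tuple G,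
        ~~ (is_path x q && (last x q == last x p))]]].

Definition path_edges x p : {set {set G}} :=
  [set e in [seq [set u.1; u.2] | u <- zip (x :: p) p]].

(* A geodesic is represented by its edge set. Two paths with at least one edge
   have the same edge set exactly when they are equal or reverses of each
   other, so this identifies a path with its reverse and nothing more. A path
   has at most #|G| - 1 edges, so the bound on k loses nothing. *)
Definition geodesics : {set {set {set G}}} :=
  \bigcup_(k < #|G|)
    [set path_edges u.1 u.2 | u : G * k.-tuple G & is_geodesic u.1 u.2].

Definition t_gp : nat := #|geodesics|.

Definition weight f (P : {set {set G}}) : nat := \sum_(e in P) f e.

(* Values of f outside [edges] play no role. *)
Definition geodesic_leech_labeling f : Prop :=
  (forall e, e \in edges -> 0 < f e) /\
  perm_eq [seq weight f P | P <- enum geodesics] (iota 1 t_gp).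

Definition geodesic_leech : Prop := exists f, geodesic_leech_labeling f.

End Geodesics.

Section Wheel.
Variable n : nat.

(* The hub is None; Some i ranges over the rim, a cycle of length n - 1
   (ordS is the cyclic successor). This is the wheel for n >= 4. *)
Definition wheel_adj : rel (option 'I_n.-1) := fun x y =>
  match x, y with
  | None, None => false
  | Some i, Some j => (i != j) && ((ordS i == j) || (ordS j == i))
  | _, _ => true
  end.

Lemma wheel_adj_sym : symmetric wheel_adj.
Proof. by move=> [i|] [j|] //=; rewrite eq_sym orbC. Qed.

Lemma wheel_adj_irr : irreflexive wheel_adj.
Proof. by move=> [i|] //=; rewrite eqxx. Qed.

Lemma wheel_adj_connected x y : connect wheel_adj x y.
Proof.
apply: (@connect_trans _ _ None).
  by case: x => [i|]; [apply: connect1 | apply: connect0].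
by case: y => [j|]; [apply: connect1 | apply: connect0].
Qed.

Definition wheel : sgraph :=
  SGraph wheel_adj_sym wheel_adj_irr wheel_adj_connected.

End Wheel.

Definition leech_wheel_orders (n : nat) : Prop :=
  5 <= n /\ geodesic_leech (wheel n).

(* Main.v *)
(* Write m = n - 1, N = m(m+3)/2, and let a(v) be 0 at the hub and the spoke
   label at a rim vertex. The geodesics are the edges, the rim paths of length
   two and the paths through the hub, so the sums a(x) + a(y) over the pairs
   of vertices that are not neighbours on the rim are distinct and miss exactly
   2m of the values 1 .. N. Up to two rim neighbours, all the a(v) lie in
   [0, N/2]; if one of them exceeds N/2 + 3m/2, then deleting it and its rim
   neighbours leaves the same situation for m - 3, without exceptions.

   For an angle t let F(t) be the sum of exp(i t a(v)), centred so that the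
   sums are symmetric about 0. Then F(t)^2 is twice the Dirichlet kernel of
   1 .. N, up to the contributions of the 2m missing values, of the m pairs of
   rim neighbours, and of the diagonal. The Dirichlet kernel is real, and very
   negative for suitable t, which forces C = Re F(t) to be small, because
   2 C^2 = |F^2| + Re F^2 = (1 + p) Re F^2 + r Im F^2 for a unit vector (p, r).
   On the other hand a combination of three such cosines is at least about 1
   on the range of the a(v), so one of the three C is of order m. For m >= 40
   (m >= 37 without exceptions) this is a contradiction. *)
From Stdlib Require Import Reals ZArith Lra.
From HB Require Import structures.
Require Import Defs.
From mathcomp Require Import all_boot zify.

Set Implicit Arguments.
Unset Strict Implicit.
Unset Printing Implicit Defensive.

Delimit Scope R_scope with Re.

(** * Geodesics of the wheel *)

Lemma eq_set2 (T : finType) (a b c d : T) :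
  [set a; b] = [set c; d] -> (a = c /\ b = d) \/ (a = d /\ b = c).
Proof.
move=> E.
have: a \in [set c; d] by rewrite -E !inE eqxx.
have: b \in [set c; d] by rewrite -E !inE eqxx orbT.
have: c \in [set a; b] by rewrite E !inE eqxx.
have: d \in [set a; b] by rewrite E !inE eqxx orbT.
rewrite !inE.
by do 4 (case/orP=> /eqP ?); subst; auto.
Qed.

Lemma set2C (T : finType) (a b : T) : [set a; b] = [set b; a].
Proof. exact: setUC. Qed.

Lemma set1_neq_set2 (T : finType) (a b c : T) : b != c -> [set a] <> [set b; c].
Proof.
by move=> bc /(congr1 (fun A : {set T} => #|A|)); rewrite cards1 cards2 bc.
Qed.

Section DiameterTwo.
Variable G : sgraph.
Hypothesis diam2 : forall x y : G, x != y -> ~~ adj x y ->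
  exists2 z, adj x z & adj z y.

(** Diameter two supplies a competitor with one or two edges for any two distinct ends, so
    minimality rules out paths with three or more edges and two-edge paths with adjacent ends. *)
Lemma is_geodesicP (x : G) (p : seq G) : reflect
  ((exists2 y, p = [:: y] & adj x y) \/
   (exists z y, [/\ p = [:: z; y], x != y, ~~ adj x y, adj x z & adj z y]))
  (is_geodesic x p).
Proof.
(* Minimality in usable form: the length [k] is kept apart from the bounded index [i], so that
   explicit tuples can be supplied. *)
have no k (q : k.-tuple G) (i : 'I_(size p)) : i = k :> nat ->
    is_geodesic x p -> is_path x q -> last x q = last x p -> False.
  move=> ik /and3P[_ _ /forallP/(_ i)]; move: q; rewrite -ik => q /forallP/(_ q).
  by move=> /negP h pq lq; apply: h; rewrite pq lq eqxx.
apply: (iffP idP) => [g|].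
- case: (boolP (adj x (last x p))) => [xy|nxy].
  + left; have [pp _ _] := and3P g; move: pp xy no g.
    case: p => [|y [|z p]] /=; first by rewrite adj_irr.
      by move=> _ xy _ _; exists y.
    move=> pp xy no g; exfalso.
    apply: (no 1 [tuple last z p] (@Ordinal (size p).+2 1 isT)) => //=.
    have [_ xl _] := and3P g.
    by rewrite /is_path /= xy inE; move: xl => /= ->.
  + right; have [pp xl _] := and3P g.
    have [z xz zl] := diam2 xl nxy.
    move: pp xl nxy zl no g; case: p => [|y [|w [|v p]]] /=.
    * by move=> _ /eqP.
    * by rewrite /is_path /= => /andP[/andP[-> _] _].
    * move=> + xw nxw zw _ _; rewrite /is_path /= => /andP[/and3P[xy yw _] _].
      by exists y, w.
    * move=> pp xl nxy zl no g; exfalso.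
      apply: (no 2 [tuple z; last v p] (@Ordinal (size p).+3 2 isT)) => //=.
      rewrite /is_path /= xz zl !inE negb_or xl !andbT /=.
      by apply/andP; split; apply/eqP=> e; move: xz zl;
        rewrite e adj_irr // -e adj_irr.
- case=> [[y -> xy]|[z [y [-> xy nxy xz zy]]]].
  + have xny : x != y by apply/eqP=> e; move: xy; rewrite e adj_irr.
    rewrite /is_geodesic /is_path /= xy inE xny /=.
    apply/forallP=> -[k] /=; rewrite ltnS leqn0 => /eqP k0.
    apply/forallP=> q; have -> : tval q = [::] by apply/size0nil; rewrite size_tuple.
    by rewrite /= xny.
  + have xnz : x != z by apply/eqP=> e; move: xz; rewrite e adj_irr.
    have zny : z != y by apply/eqP=> e; move: zy; rewrite e adj_irr.
    rewrite /is_geodesic /is_path /= xz zy !inE negb_or xy xnz zny /=.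
    apply/forallP=> -[k] /= k2; apply/forallP=> -[[|a [|b q]] /= sq].
    * by rewrite xy.
    * by apply/negP=> /andP[/andP[/andP[xa _] _] /eqP e]; move: nxy; rewrite -e xa.
    * by move: k2; rewrite -(eqP sq).
Qed.

Lemma mem_geodesics (P : {set {set G}}) : 2 < #|G| -> reflect
  ((exists x y, adj x y /\ P = [set [set x; y]]) \/
   (exists x z y, [/\ x != y, ~~ adj x y, adj x z, adj z y &
      P = [set [set x; z]; [set z; y]]]))
  (P \in geodesics G).
Proof.
move=> G2; apply: (iffP idP).
- move=> /bigcupP[k _ /imsetP[[x p]]]; rewrite inE /= => /is_geodesicP h ->.
  case: h => [[y -> xy]|[z [y [-> xy nxy xz zy]]]]; [left; exists x, y | right].
    by split=> //; apply/setP=> e; rewrite /path_edges !inE.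
  by exists x, z, y; split=> //; apply/setP=> e; rewrite /path_edges !inE.
- case=> [[x [y [xy ->]]]|[x [z [y [xy nxy xz zy ->]]]]].
  + apply/bigcupP; exists (Ordinal (leq_ltn_trans (isT : 1 <= 2) G2)) => //.
    apply/imsetP; exists (x, [tuple y]).
      by rewrite inE; apply/is_geodesicP; left; exists y.
    by apply/setP=> e; rewrite /path_edges !inE.
  + apply/bigcupP; exists (Ordinal G2) => //.
    apply/imsetP; exists (x, [tuple z; y]).
      by rewrite inE; apply/is_geodesicP; right; exists z, y.
    by apply/setP=> e; rewrite /path_edges !inE.
Qed.

End DiameterTwo.

(* For [i < j < m]: distinct and not adjacent on the rim. *)
Definition far (m i j : nat) : bool := (i.+1 < j) && (j.+1 < i + m).

Definition cyclic_succ (m i : nat) : nat := if i.+1 == m then 0 else i.+1.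

Lemma val_ordS m (i : 'I_m) : ordS i = cyclic_succ m i :> nat.
Proof.
rewrite /cyclic_succ /=; case: eqP => [->|e]; first by rewrite modnn.
by rewrite modn_small //; have := ltn_ord i; lia.
Qed.

Lemma wheel_adjC m (x y : option 'I_m) :
  @wheel_adj m.+1 x y = @wheel_adj m.+1 y x.
Proof. exact: (@wheel_adj_sym m.+1). Qed.

Lemma wheel_adj_far m (i j : 'I_m) : i < j ->
  @wheel_adj m.+1 (Some i) (Some j) = ~~ far m i j.
Proof.
move=> ij; rewrite /wheel_adj /far.
have -> : (i == j) = false by apply/eqP=> e; rewrite e ltnn in ij.
rewrite -!(inj_eq (@ord_inj _)) !val_ordS /cyclic_succ.
by have := ltn_ord i; have := ltn_ord j; do 2 case: ifP => /=; lia.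
Qed.

Section WheelGeodesics.
Variable m : nat.
Hypothesis m_ge4 : 3 < m.

Definition spoke (i : 'I_m) : {set option 'I_m} := [set None; Some i].
Definition rim (i : 'I_m) : {set option 'I_m} := [set Some i; Some (ordS i)].

Definition far_pairs : seq ('I_m * 'I_m) :=
  [seq p : 'I_m * 'I_m <- [seq (i, j) | i <- enum 'I_m, j <- enum 'I_m]
    | far m p.1 p.2].

Lemma mem_far_pairs p : (p \in far_pairs) = far m p.1 p.2.
Proof.
rewrite mem_filter andbC; case: p => i j /=.
by rewrite (allpairs_f (fun i j => (i, j))) ?mem_enum.
Qed.

Lemma far_pairs_uniq : uniq far_pairs.
Proof.
by rewrite filter_uniq // allpairs_uniq ?enum_uniq // => -[i j] [k l].
Qed.

Lemma ordS_neq (i : 'I_m) : i != ordS i.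
Proof.
apply/eqP => /(congr1 (@nat_of_ord _)); rewrite !val_ordS /cyclic_succ.
by have := ltn_ord i; do 1 case: ifP => /=; lia.
Qed.

Lemma ordS2_neq (i : 'I_m) : i != ordS (ordS i).
Proof.
apply/eqP => /(congr1 (@nat_of_ord _)); rewrite !val_ordS /cyclic_succ.
by have := ltn_ord i; do 2 case: ifP => /=; lia.
Qed.

(** This is where a rim of length three would fail. It makes [i] and [ordS (ordS i)] non-adjacent,
    so that every rim path of length two is a geodesic. *)
Lemma ordS3_neq (i : 'I_m) : i != ordS (ordS (ordS i)).
Proof.
apply/eqP => /(congr1 (@nat_of_ord _)); rewrite !val_ordS /cyclic_succ.
by have := ltn_ord i; do 3 case: ifP => /=; lia.
Qed.

Lemma spoke_inj : injective spoke.
Proof. by move=> i j /eq_set2[[_ []]|[]]. Qed.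

Lemma rim_inj : injective rim.
Proof.
move=> i j /eq_set2[[[//]]|[[->] [/eqP]]].
by rewrite eq_sym (negPf (ordS2_neq _)).
Qed.

Lemma spoke_neq_rim i j : spoke i != rim j.
Proof. by apply/eqP => /eq_set2[[]|[]]. Qed.

Lemma far_neq (p : 'I_m * 'I_m) : far m p.1 p.2 -> p.1 != p.2.
Proof. by case: p => i j /=; apply: contraTneq => ->; rewrite /far; lia. Qed.

(** Rim vertices at rim distance two occur twice, once joined along the rim and once through the
    hub; for [m = 4] there are even two rim paths between them. *)
Definition geodesic_seq : seq {set {set option 'I_m}} :=
  [seq [set spoke i] | i <- enum 'I_m] ++
  [seq [set rim i] | i <- enum 'I_m] ++
  [seq [set rim i; rim (ordS i)] | i <- enum 'I_m] ++
  [seq [set spoke p.1; spoke p.2] | p <- far_pairs].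

Lemma geodesic_seq_uniq : uniq geodesic_seq.
Proof.
have rS i : rim i != rim (ordS i) by rewrite (inj_eq rim_inj) ordS_neq.
have sS p : p \in far_pairs -> spoke p.1 != spoke p.2.
  by rewrite mem_far_pairs (inj_eq spoke_inj) => /far_neq.
rewrite !cat_uniq !has_cat !negb_or; apply/and5P; split.
- by rewrite map_inj_uniq ?enum_uniq // => i j /set1_inj/spoke_inj.
- apply/and3P; split; apply/hasPn => _ /mapP[i ip ->]; apply/mapP => -[j _].
  + by move/set1_inj/esym/eqP; apply/negP/spoke_neq_rim.
  + by move/esym/(set1_neq_set2 (rS _)).
  + by move/esym/(set1_neq_set2 (sS _ ip)).
- by rewrite map_inj_uniq ?enum_uniq // => i j /set1_inj/rim_inj.
- apply/andP; split; apply/hasPn => _ /mapP[i ip ->]; apply/mapP => -[j _].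
  + by move/esym/(set1_neq_set2 (rS _)).
  + by move/esym/(set1_neq_set2 (sS _ ip)).
- apply/and3P; split.
  + rewrite map_inj_uniq ?enum_uniq // => i j.
    move=> /eq_set2[[/rim_inj//]|[/rim_inj-> /rim_inj/eqP]].
    by rewrite eq_sym (negPf (ordS2_neq _)).
  + apply/hasPn => _ /mapP[i ip ->]; apply/mapP => -[j _].
    by move=> /eq_set2[[/eqP+ _]|[/eqP+ _]]; rewrite (negPf (spoke_neq_rim _ _)).
  + rewrite map_inj_in_uniq ?far_pairs_uniq // => -[i j] [k l].
    rewrite !mem_far_pairs /= => /andP[ij _] /andP[kl _].
    move=> /eq_set2[[/spoke_inj-> /spoke_inj->//]|[/spoke_inj e1 /spoke_inj e2]].
    by move: ij kl; rewrite e1 e2; lia.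
Qed.

Lemma wheel_diam2 (x y : wheel m.+1) : x != y -> ~~ adj x y ->
  exists2 z, adj x z & adj z y.
Proof.
by case: x y => [i|] [j|] // _ _; exists None.
Qed.

Lemma geodesics_wheel : geodesics (wheel m.+1) =i geodesic_seq.
Proof.
have c2 : 2 < #|wheel m.+1| by rewrite card_option card_ord; lia.
have adjS i j : adj (Some i : wheel m.+1) (Some j) -> ordS i = j \/ ordS j = i.
  by move=> /= /andP[_ /orP[/eqP|/eqP]]; auto.
move=> P; apply/(mem_geodesics (@wheel_diam2) P c2)/idP.
- rewrite !mem_cat; case=> [[x [y [xy ->]]]|[x [z [y [xy nxy xz zy ->]]]]].
  + case: x y xy => [i|] [j|] //.
    * case/adjS => <-; apply/or4P/Or42/mapP; [exists i|exists j] => //;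
      by rewrite ?mem_enum // /rim setUC.
    * by move=> _; apply/or4P/Or41/mapP; exists i; rewrite ?mem_enum // /spoke setUC.
    * by move=> _; apply/or4P/Or41/mapP; exists j; rewrite ?mem_enum // /spoke.
  + case: x y z xy nxy xz zy => [i|] [j|] [k|] //.
    * move=> ij nij /adjS ik /adjS kj; apply/or4P/Or43/mapP.
      (* Two steps in the same rim direction give a rim path; opposite directions return to the
         starting vertex. *)
      case: ik => e1; case: kj => e2.
      - by exists i; rewrite ?mem_enum // -e2 -e1.
      - by case/eqP: ij; congr Some; apply: (@ordS_inj m); rewrite e1 e2.
      - by case/eqP: ij; rewrite -e1 -e2.
      - exists j; rewrite ?mem_enum // /rim e2 e1.
        by rewrite (set2C (Some i)) (set2C (Some k) (Some j)) set2C.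
    * move=> ij nij _ _; apply/or4P/Or44/mapP.
      have [lt|lt|e] := ltngtP i j.
      - exists (i, j); last by rewrite /spoke [X in [set X; _]]setUC.
        by move: nij; rewrite mem_far_pairs [adj _ _]wheel_adj_far ?negbK.
      - exists (j, i).
          by move: nij; rewrite mem_far_pairs [adj _ _]wheel_adjC wheel_adj_far ?negbK.
        by rewrite /spoke setUC [X in [set _; X]]setUC.
      - by move: ij; rewrite (val_inj e) eqxx.
- rewrite !mem_cat => /or4P[] /mapP[i ip ->].
  + by left; exists None, (Some i).
  + left; exists (Some i), (Some (ordS i)); split=> //=.
    by rewrite ordS_neq eqxx.
  + right; exists (Some i), (Some (ordS i)), (Some (ordS (ordS i))).
    split=> //=; rewrite ?ordS_neq ?eqxx //.
    * by apply/eqP => -[] /eqP; rewrite (negPf (ordS2_neq _)).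
    * rewrite (inj_eq (@ordS_inj _)) (negPf (ordS_neq _)) [_ == i]eq_sym.
      by rewrite (negPf (ordS3_neq _)) andbF.
  + right; move: ip; rewrite mem_far_pairs; case: i => i j /= ij.
    have lt : i < j by move: ij; rewrite /far; lia.
    exists (Some i), None, (Some j); split=> //.
    * by apply/eqP => -[] e; rewrite e ltnn in lt.
    * by rewrite -[X in ~~ X]/(@wheel_adj m.+1 (Some i) (Some j)) wheel_adj_far ?ij.
    * by rewrite /spoke [X in [set X; _]]setUC.
Qed.

Definition wheel_weights (s r : 'I_m -> nat) : seq nat :=
  [seq s i | i <- enum 'I_m] ++ [seq r i | i <- enum 'I_m] ++
  [seq r i + r (ordS i) | i <- enum 'I_m] ++ [seq s p.1 + s p.2 | p <- far_pairs].

Lemma perm_wheel_weights (f : {set wheel m.+1} -> nat) :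
  perm_eq [seq weight f P | P <- enum (geodesics (wheel m.+1))]
          (wheel_weights (f \o spoke) (f \o rim)).
Proof.
have /(perm_map (weight f)) : perm_eq (enum (geodesics (wheel m.+1))) geodesic_seq.
  apply: uniq_perm; rewrite ?enum_uniq ?geodesic_seq_uniq // => P.
  by rewrite mem_enum geodesics_wheel.
rewrite (_ : map _ geodesic_seq = wheel_weights (f \o spoke) (f \o rim)) //.
have w1 e : weight f [set e] = f e by rewrite /weight big_set1.
have w2 e e' : e != e' -> weight f [set e; e'] = f e + f e'.
  by move=> ee; rewrite /weight big_setU1 ?big_set1 // inE.
rewrite !map_cat -!(map_comp (weight f)); congr (_ ++ (_ ++ (_ ++ _))).
- by apply: eq_map => i /=; rewrite w1.
- by apply: eq_map => i /=; rewrite w1.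
- by apply: eq_map => i /=; rewrite w2 // (inj_eq rim_inj) ordS_neq.
- apply/eq_in_map => p; rewrite mem_far_pairs => /far_neq pp /=.
  by rewrite w2 // (inj_eq spoke_inj).
Qed.

End WheelGeodesics.

Section LeechWheel.
Variable m : nat.
Hypothesis m_ge4 : 3 < m.

Lemma edges_wheelP (e : {set wheel m.+1}) :
  (e \in edges (wheel m.+1)) <->
  (exists i : 'I_m, e = spoke i) \/ (exists i : 'I_m, e = rim i).
Proof.
split=> [/imsetP[[x y] /=]|].
- rewrite inE /= => xy ->; case: x y xy => [i|] [j|] //= h.
  + case/andP: h => _ /orP[] /eqP <-; right; [by exists i | exists j].
    exact: set2C.
  + by left; exists i; rewrite set2C.
  + by left; exists j.
- case=> -[i ->]; apply/imsetP.
  + by exists (None, Some i); rewrite ?inE.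
  + by exists (Some i, Some (ordS i)) => //; rewrite inE /= ordS_neq ?eqxx.
Qed.

Lemma t_gp_wheel (s r : 'I_m -> nat) : t_gp (wheel m.+1) = size (wheel_weights s r).
Proof.
rewrite /t_gp cardE.
rewrite (perm_size (_ : perm_eq _ (geodesic_seq m))).
  by rewrite !size_cat !size_map.
apply: uniq_perm; rewrite ?enum_uniq ?geodesic_seq_uniq // => P.
by rewrite mem_enum geodesics_wheel.
Qed.

Lemma geodesic_leech_wheelP : geodesic_leech (wheel m.+1) <->
  exists s r : 'I_m -> nat, [/\ forall i, 0 < s i, forall i, 0 < r i &
    perm_eq (wheel_weights s r) (iota 1 (size (wheel_weights s r)))].
Proof.
split=> [[f [f0 fP]]|[s [r [s0 r0 srP]]]].
- exists (f \o @spoke m), (f \o @rim m); split=> [i|i|].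
  + by apply: f0; apply/edges_wheelP; left; exists i.
  + by apply: f0; apply/edges_wheelP; right; exists i.
  + by rewrite -t_gp_wheel -(permPl (perm_wheel_weights m_ge4 f)).
(* Spokes and rim edges never coincide and both indexings are injective, so the picked index is the
   intended one. *)
- pose f (e : {set wheel m.+1}) :=
    if [pick i | spoke i == e] is Some i then s i else
    if [pick i | rim i == e] is Some i then r i else 0.
  have fs i : f (spoke i) = s i.
    rewrite /f; case: pickP => [j /eqP/spoke_inj->//|/(_ i)].
    by rewrite eqxx.
  have fr i : f (rim i) = r i.
    rewrite /f; case: pickP => [j|_]; first by rewrite (negPf (spoke_neq_rim _ _)).
    case: pickP => [j /eqP/(rim_inj m_ge4)->//|/(_ i)].
    by rewrite eqxx.
  exists f; split=> [e /edges_wheelP[] [i ->]|]; rewrite ?fs ?fr //.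
  rewrite (permPl (perm_wheel_weights m_ge4 f)) (t_gp_wheel s r).
  suff <- : wheel_weights s r = wheel_weights (f \o @spoke m) (f \o @rim m) by [].
  congr (_ ++ (_ ++ (_ ++ _))); apply: eq_map => i /=; rewrite ?fs ?fr //.
Qed.

End LeechWheel.

(** * Labelings for small orders *)

(** A counterpart of [wheel_weights] on plain lists of numbers, suited to evaluation by
    [vm_compute]. *)
Definition list_weights (m : nat) (s r : seq nat) : seq nat :=
  s ++ r ++ [seq nth 0 r i + nth 0 r (cyclic_succ m i) | i <- iota 0 m] ++
  [seq nth 0 s p.1 + nth 0 s p.2
    | p <- [seq (i, j) | i <- iota 0 m, j <- iota 0 m] & far m p.1 p.2].

Definition leech_lists (m : nat) (s r : seq nat) : bool :=
  [&& size s == m, size r == m, all (ltn 0) (s ++ r) &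
      perm_eq (list_weights m s r) (iota 1 (size (list_weights m s r)))].

Lemma list_weightsE m (s r : seq nat) : size s = m -> size r = m ->
  wheel_weights (fun i : 'I_m => nth 0 s i) (fun i : 'I_m => nth 0 r i) =
  list_weights m s r.
Proof.
move=> sm rm; rewrite /wheel_weights /list_weights.
have val_map (t : seq nat) : size t = m -> [seq nth 0 t (val i) | i <- enum 'I_m] = t.
  by move=> tm; rewrite (map_comp (nth 0 t)) val_enum_ord -tm map_nth_iota0 ?take_size.
rewrite !val_map //; congr (_ ++ (_ ++ (_ ++ _))).
- rewrite -[in RHS]val_enum_ord -map_comp; apply: eq_map => i /=.
  by rewrite -(val_ordS i).
- rewrite -[in RHS]val_enum_ord allpairs_mapl allpairs_mapr.
  rewrite -(map_allpairs (fun p : 'I_m * 'I_m => (val p.1, val p.2)) (fun i j => (i, j))).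
  by rewrite filter_map -map_comp.
Qed.

Lemma leech_lists_wheel m s r : 3 < m -> leech_lists m s r -> leech_wheel_orders m.+1.
Proof.
move=> m4 /and4P[/eqP sm /eqP rm]; rewrite all_cat => /andP[s0 r0] srP.
split; first by lia.
apply/(geodesic_leech_wheelP m4).
exists (fun i : 'I_m => nth 0 s i), (fun i : 'I_m => nth 0 r i).
rewrite list_weightsE //; split=> // i.
  by apply: (allP s0); rewrite mem_nth ?sm.
by apply: (allP r0); rewrite mem_nth ?rm.
Qed.

Lemma leech_wheel_small n : 5 <= n <= 13 -> leech_wheel_orders n.
Proof.
case: n => // m /andP[m4 m12].
have [s [r h]] : exists s r, leech_lists m s r.
  have : m \in iota 4 9 by rewrite mem_iota; lia.
  rewrite !inE => /or4P[/eqP->|/eqP->|/eqP->|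
    /or4P[/eqP->|/eqP->|/eqP->|/or3P[/eqP->|/eqP->|/eqP->]]].
  (* In each witness the first list holds the spoke labels in rim order; entry [i] of the second
     labels the rim edge from [i] to its successor. *)
  - by exists [:: 3; 5; 4; 6], [:: 1; 8; 2; 12]; vm_compute.
  - by exists [:: 5; 8; 10; 4; 3], [:: 1; 6; 14; 2; 17]; vm_compute.
  - exists [:: 3; 11; 2; 10; 4; 12].
    by exists [:: 1; 17; 9; 16; 8; 19]; vm_compute.
  - exists [:: 19; 17; 1; 14; 15; 4; 11].
    by exists [:: 2; 8; 27; 3; 6; 7; 22]; vm_compute.
  - exists [:: 13; 9; 5; 15; 14; 26; 29; 7].
    by exists [:: 1; 2; 4; 32; 8; 17; 20; 10]; vm_compute.
  - exists [:: 1; 3; 12; 22; 38; 32; 7; 15; 14].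
    by exists [:: 2; 28; 6; 43; 5; 4; 20; 11; 40]; vm_compute.
  - exists [:: 27; 4; 20; 2; 18; 35; 13; 24; 30; 1].
    by exists [:: 7; 9; 54; 10; 46; 12; 11; 41; 8; 53]; vm_compute.
  - exists [:: 4; 20; 39; 1; 38; 2; 36; 25; 15; 30; 8].
    by exists [:: 7; 11; 48; 14; 57; 13; 52; 24; 49; 12; 60]; vm_compute.
  - exists [:: 25; 21; 46; 43; 3; 42; 2; 44; 30; 16; 36; 10].
    by exists [:: 1; 34; 50; 20; 9; 8; 6; 77; 4; 7; 15; 74]; vm_compute.
exact: leech_lists_wheel h.
Qed.

(** * Almost Sidon sets from labelings *)

Definition rim_adj m (x y : option 'I_m) : bool :=
  if (x, y) is (Some i, Some j) then (ordS i == j) || (ordS j == i) else false.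

Lemma rim_adjC m (x y : option 'I_m) : rim_adj x y = rim_adj y x.
Proof. by case: x y => [i|] [j|] //; rewrite /rim_adj orbC. Qed.

Lemma rim_adj_far m (i j : 'I_m) : 3 < m -> i < j ->
  rim_adj (Some i) (Some j) = ~~ far m i j.
Proof.
move=> m4 ij; rewrite -wheel_adj_far //=.
by have -> : i != j by apply: contraTneq ij => ->; rewrite ltnn.
Qed.

Lemma card_rim_adj m (i : 'I_m) : #|[pred x | rim_adj (Some i) x]| <= 2.
Proof.
apply: leq_trans (_ : #|[set Some (ordS i); Some (ord_pred i)]| <= 2).
  apply/subset_leq_card/subsetP => -[j|]; rewrite !inE //= => /orP[/eqP<-|/eqP<-].
    by rewrite eqxx.
  by rewrite ordSK eqxx orbT.
by rewrite cards2; case: (_ != _).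
Qed.

Lemma size_far_pairs m : 3 < m -> 2 * size (far_pairs m) = m * (m - 3).
Proof.
move=> m4.
(* For each ordered pair exactly one of the five indicators is 1. The first three contribute [m]
   each, the last two are equal by symmetry. *)
have tot : \sum_(i < m) \sum_(j < m) ((i == j) + (ordS i == j) + (ordS j == i)
    + far m i j + far m j i) = m * m.
  have -> : m * m = \sum_(i < m) \sum_(j < m) 1.
    by rewrite !sum_nat_const !card_ord muln1.
  apply: eq_bigr => i _; apply: eq_bigr => j _.
  rewrite -!(inj_eq (@ord_inj _)) !val_ordS /far /cyclic_succ.
  have := ltn_ord i; have := ltn_ord j.
  by do 2 case: ifP => /=; lia.
have one (i : 'I_m) : \sum_(j < m) (i == j) = 1.
  by rewrite (bigD1 i) //= eqxx big1 // => j; rewrite eq_sym => /negPf->.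
have farE : \sum_(i < m) \sum_(j < m) far m i j = size (far_pairs m).
  rewrite pair_big -(card_uniqP (far_pairs_uniq m)) -sum1_card /= [RHS]big_mkcond /=.
  by apply: eq_bigr => p _; rewrite mem_far_pairs; case: far.
have E1 : \sum_(i < m) \sum_(j < m) (ordS i == j) = m.
  by under eq_bigr do rewrite one; rewrite sum_nat_const card_ord muln1.
have E0 : \sum_(i < m) \sum_(j < m) (i == j) = m.
  by under eq_bigr do rewrite one; rewrite sum_nat_const card_ord muln1.
move: tot; under eq_bigr do rewrite !big_split /=.
rewrite !big_split /= farE E0 E1.
rewrite [X in _ + X + _ + _]exchange_big /= E1.
rewrite [X in _ + X]exchange_big /= farE; nia.
Qed.

(** A weak Sidon condition with the pairs related by [e] exempted. The set [A] is a parameter so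
    that vertices can be deleted later. *)
Definition almost_sidon (T : finType) (e : rel T) (a : T -> nat) (N : nat)
    (A : {set T}) : Prop :=
  {in A &, forall x y, x != y -> ~~ e x y -> 0 < a x + a y <= N} /\
  {in A &, forall x y, {in A &, forall x' y',
    x != y -> ~~ e x y -> x' != y' -> ~~ e x' y' ->
    a x + a y = a x' + a y' -> (x, y) = (x', y') \/ (x, y) = (y', x')}}.

Lemma uniq_map_inj_in (T T' : eqType) (f : T -> T') (s : seq T) :
  uniq (map f s) -> {in s &, injective f}.
Proof.
move=> u x y xs ys e; rewrite -(nth_index x xs) -(nth_index x ys); congr nth.
apply/eqP; rewrite -(nth_uniq (f x) _ _ u) ?size_map ?index_mem //.
by rewrite !(nth_map x) ?index_mem // !nth_index // e.
Qed.

(** The spoke labels are sums with the hub, so spokes and hub paths together account for all far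
    pairs. The weights of rim edges and rim paths are discarded; they become the missing values. *)
Lemma leech_almost_sidon m : 3 < m -> geodesic_leech (wheel m.+1) ->
  exists2 a : option 'I_m -> nat, a None = 0 &
    almost_sidon (@rim_adj m) a (m * (m + 3))./2 setT.
Proof.
move=> m4 /(geodesic_leech_wheelP m4)[s [r [s0 r0 srP]]].
pose a (x : option 'I_m) := oapp s 0 x.
exists a => //.
(* Three blocks of [m] weights and [m(m-3)/2] far pairs add up to [m(m+3)/2]. *)
have sz : size (wheel_weights s r) = (m * (m + 3))./2.
  have szE (f : 'I_m -> nat) : size [seq f i | i <- enum 'I_m] = m.
    by rewrite size_map -cardE card_ord.
  rewrite !size_cat !szE size_map.
  by have := size_far_pairs m4; nia.
rewrite sz in srP; set N := (_./2) in srP *.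
pose I := [seq (None, Some i) | i <- enum 'I_m] ++
  [seq (Some p.1, Some p.2) | p <- far_pairs m].
pose sg (p : option 'I_m * option 'I_m) := a p.1 + a p.2.
have sgI : [seq sg p | p <- I] =
    [seq s i | i <- enum 'I_m] ++ [seq s p.1 + s p.2 | p <- far_pairs m].
  by rewrite map_cat -!map_comp; congr (_ ++ _); apply: eq_map.
have sgP : perm_eq ([seq sg p | p <- I] ++
    ([seq r i | i <- enum 'I_m] ++ [seq r i + r (ordS i) | i <- enum 'I_m]))
    (iota 1 N).
  rewrite -(permPr srP) sgI /wheel_weights -catA perm_cat2l perm_catC.
  by rewrite -catA perm_cat2l.
have sgr p : p \in I -> 0 < sg p <= N.
  move=> pI; have : sg p \in iota 1 N by rewrite -(perm_mem sgP) mem_cat map_f.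
  by rewrite mem_iota; lia.
have sg_inj : {in I &, injective sg}.
  apply: uniq_map_inj_in; have := iota_uniq 1 N.
  by rewrite -(perm_uniq sgP) cat_uniq => /and3P[].
have inI x y : x != y -> ~~ rim_adj x y -> ((x, y) \in I) || ((y, x) \in I).
  have h1 (i : 'I_m) : (None, Some i) \in I by rewrite mem_cat map_f ?mem_enum.
  have h2 (i j : 'I_m) : far m i j -> (Some i, Some j) \in I.
    move=> f; rewrite mem_cat; apply/orP; right; apply/mapP.
    by exists (i, j); rewrite ?mem_far_pairs.
  case: x y => [i|] [j|] //; rewrite ?h1 ?orbT //.
  move=> ij nij; have [lt|lt|/ord_inj eq] := ltngtP i j.
  - by rewrite h2 // -[far _ _ _]negbK -rim_adj_far.
  - by rewrite orbC h2 // -[far _ _ _]negbK -rim_adj_far // rim_adjC.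
  - by rewrite eq eqxx in ij.
have sgC x y : sg (x, y) = sg (y, x) by rewrite /sg /= addnC.
split=> [x y _ _ xy nxy|x y _ _ x' y' _ _ xy nxy xy' nxy' e].
  rewrite -[a x + a y]/(sg (x, y)).
  by case/orP: (inI _ _ xy nxy) => /sgr //; rewrite sgC.
rewrite -[a x + a y]/(sg (x, y)) -[a x' + a y']/(sg (x', y')) in e.
case/orP: (inI _ _ xy nxy) => h; case/orP: (inI _ _ xy' nxy') => h'.
- by left; apply: sg_inj.
- by right; apply: sg_inj; rewrite // e sgC.
- by right; have [-> ->] : (y, x) = (x', y') by apply: sg_inj; rewrite // sgC e.
- by left; have [-> ->] : (y, x) = (y', x') by apply: sg_inj; rewrite // sgC e sgC.
Qed.

(** * Real addition and multiplication as laws for big operators *)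

HB.instance Definition _ := Monoid.isComLaw.Build R 0%Re Rplus
  (fun x y z => esym (Rplus_assoc x y z)) Rplus_comm Rplus_0_l.
HB.instance Definition _ := Monoid.isMulLaw.Build R 0%Re Rmult Rmult_0_l Rmult_0_r.
HB.instance Definition _ := Monoid.isAddLaw.Build R Rmult Rplus
  Rmult_plus_distr_r Rmult_plus_distr_l.

(** * Positivity of integer polynomials on intervals *)

Section PolyPositivity.
Open Scope Z_scope.

Fixpoint padd (p q : list Z) : list Z :=
  match p, q with
  | nil, _ => q
  | _, nil => p
  | a :: p', b :: q' => (a + b) :: padd p' q'
  end.

Definition pscale (c : Z) (p : list Z) : list Z := List.map (Z.mul c) p.

Definition pmul_lin (l r : Z) (p : list Z) : list Z :=
  padd (pscale l p) (0 :: pscale r p).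

(* The pair [(d(1+s))^n p((l + r s)/(d(1+s))), (d(1+s))^n], [n] the length of
   [p], as polynomials in [s]; s ranges over [0, oo) as the argument of [p]
   ranges over [l/d, r/d). *)
Fixpoint mobius (l r d : Z) (p : list Z) : list Z * list Z :=
  match p with
  | nil => (nil, 1 :: nil)
  | c :: p' =>
    let (h, w) := mobius l r d p' in
    let w' := pmul_lin d d w in
    (padd (pscale c w') (pmul_lin l r h), w')
  end.

(** Up to positive factors the coefficients tested are Bernstein coefficients of [p] on the
    interval. If one is negative the interval is bisected, with the denominator doubled to keep the
    midpoint integral. *)
Fixpoint pos_check (fuel : nat) (l r d : Z) (p : list Z) : bool :=
  List.forallb (Z.leb 0) (fst (mobius l r d p)) ||
  match fuel with
  | O => false
  | S n => pos_check n (2 * l) (l + r) (2 * d) p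
        && pos_check n (l + r) (2 * r) (2 * d) p
  end.

End PolyPositivity.

Local Open Scope R_scope.

Fixpoint peval (p : list Z) (x : R) : R :=
  if p is c :: p' then IZR c + x * peval p' x else 0.

Lemma peval_add p q x : peval (padd p q) x = peval p x + peval q x.
Proof.
elim: p q => [|a p IH] [|b q] /=; try ring.
by rewrite IH plus_IZR; ring.
Qed.

Lemma peval_scale c p x : peval (pscale c p) x = IZR c * peval p x.
Proof. by elim: p => [|a p IH] /=; rewrite ?IH ?mult_IZR; ring. Qed.

Lemma peval_mul_lin l r p x :
  peval (pmul_lin l r p) x = (IZR l + IZR r * x) * peval p x.
Proof. by rewrite peval_add /= !peval_scale; ring. Qed.

Lemma peval_ge0 p x : 0 <= x -> List.forallb (Z.leb 0) p -> 0 <= peval p x.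
Proof.
move=> x0; elim: p => [|c p IH] /=; first lra.
move=> /andP[/Z.leb_le/IZR_le c0 /IH p0].
by apply: Rplus_le_le_0_compat => //; apply: Rmult_le_pos.
Qed.

Lemma peval_mobius l r d p u s : IZR d * (1 + s) * u = IZR l + IZR r * s ->
  peval (mobius l r d p).1 s = peval (mobius l r d p).2 s * peval p u.
Proof.
move=> us; elim: p => [|c p] /=; first by ring.
case: (mobius l r d p) => h w /= IH.
rewrite peval_add peval_scale !peval_mul_lin IH -us; ring.
Qed.

Lemma peval_mobius_gt0 l r d p s : 0 < IZR d -> 0 <= s ->
  0 < peval (mobius l r d p).2 s.
Proof.
move=> d0 s0; elim: p => [|c p] /=; first lra.
case: (mobius l r d p) => h w /= IH.
by rewrite peval_mul_lin; apply: Rmult_lt_0_compat => //; nra.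
Qed.

Lemma mobius_sound l r d p u : 0 < IZR d ->
  List.forallb (Z.leb 0) (mobius l r d p).1 ->
  IZR l <= IZR d * u < IZR r -> 0 <= peval p u.
Proof.
(* The inverse of the substitution [u = (l + r s) / (d (1 + s))]; the strict upper bound on [u]
   keeps the denominator positive. *)
move=> d0 chk [lu ur]; pose s := (IZR d * u - IZR l) / (IZR r - IZR d * u).
have s0 : 0 <= s by apply: Rmult_le_pos; [lra | apply/Rlt_le/Rinv_0_lt_compat; lra].
have us : IZR d * (1 + s) * u = IZR l + IZR r * s by rewrite /s; field; lra.
have w0 := @peval_mobius_gt0 l r d p s d0 s0.
have h0 := peval_ge0 s0 chk; rewrite (peval_mobius p us) in h0.
by apply: (Rmult_le_reg_l _ _ _ w0); lra.
Qed.

Lemma pos_check_sound fuel l r d p u : 0 < IZR d -> pos_check fuel l r d p ->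
  IZR l <= IZR d * u < IZR r -> 0 <= peval p u.
Proof.
move=> d0; elim: fuel l r d d0 => [|n IH] l r d d0.
  by rewrite /pos_check orbF; apply: mobius_sound.
case/orP; first exact: mobius_sound.
move=> /andP[h1 h2] [lu ur].
have d2 : 0 < IZR (2 * d) by rewrite mult_IZR; lra.
have [lt|ge] := Rlt_le_dec (2 * (IZR d * u)) (IZR (l + r)).
- by apply: (IH _ _ _ d2 h1); rewrite ?mult_IZR; lra.
- by apply: (IH _ _ _ d2 h2); rewrite ?mult_IZR; lra.
Qed.

(** * The numerical certificate *)

(** The Chebyshev polynomials [T_2], [T_3] and [T_6], the last one as the composition of [T_2] with
    [T_3]. *)
Definition cheb2 (u : R) : R := 2 * u ^ 2 - 1.
Definition cheb3 (u : R) : R := 4 * u ^ 3 - 3 * u.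
Definition cheb6 (u : R) : R := 2 * cheb3 u ^ 2 - 1.

Lemma cheb2_bound u : -1 <= u -> u <= 1 -> -1 <= cheb2 u <= 1.
Proof. by rewrite /cheb2 => lu ur; split; nra. Qed.

Lemma cheb3_bound u : -1 <= u -> u <= 1 -> -1 <= cheb3 u <= 1.
Proof.
move=> lu ur; suff h : 0 <= 1 - cheb3 u ^ 2 by split; nra.
(* The polynomial form of [sin(3x)^2 = sin(x)^2 (4 cos(x)^2 - 1)^2]. *)
have -> : 1 - cheb3 u ^ 2 = (1 - u ^ 2) * (4 * u ^ 2 - 1) ^ 2 by rewrite /cheb3; ring.
by apply: Rmult_le_pos; [nra | apply: pow2_ge_0].
Qed.

Lemma cheb6_bound u : -1 <= u -> u <= 1 -> -1 <= cheb6 u <= 1.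
Proof. by move=> lu ur; have := cheb3_bound lu ur; rewrite /cheb6; split; nra. Qed.

Definition cheb_comb (c0 c2 c3 c6 : Z) : list Z :=
  padd (c0 :: nil) (padd (pscale c2 [:: -1; 0; 2]%Z)
    (padd (pscale c3 [:: 0; -3; 0; 4]%Z)
          (pscale c6 [:: -1; 0; 18; 0; -48; 0; 32]%Z))).

Lemma peval_cheb_comb c0 c2 c3 c6 u : peval (cheb_comb c0 c2 c3 c6) u =
  IZR c0 + IZR c2 * cheb2 u + IZR c3 * cheb3 u + IZR c6 * cheb6 u.
Proof.
by rewrite !peval_add !peval_scale /cheb6 /cheb2 /cheb3 /=; ring.
Qed.

Lemma cheb_ge0 fuel l r d c0 c2 c3 c6 u : 0 < IZR d ->
  pos_check fuel l r d (cheb_comb c0 c2 c3 c6) ->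
  IZR l <= IZR d * u < IZR r ->
  0 <= IZR c0 + IZR c2 * cheb2 u + IZR c3 * cheb3 u + IZR c6 * cheb6 u.
Proof. by rewrite -peval_cheb_comb; apply: pos_check_sound. Qed.

(* Over all unit vectors [(p, r)], [(1 + p) x + r y] is at most
   [x + (x^2 + y^2 + q^2) / (2 q)], for every [q > 0]. Here [(x, y)] is
   [- 2 (cos z, sin z) - (s, 0)] for a missing value and
   [(cos z, sin z) - (s, 0)] for an adjacent pair, with [t = cos z]. The
   shares [s] redistribute the negative main term [D] of the energy over the
   missing values and the adjacent pairs. *)
Definition missing_term (s q t : R) : R :=
  - (2 * t + s) + (4 + 4 * t * s + s ^ 2 + q ^ 2) / (2 * q).

Definition adjacent_term (s q t : R) : R :=
  (t - s) + (1 - 2 * t * s + s ^ 2 + q ^ 2) / (2 * q).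

(* The weights, the coefficients in [gain] and the shares come from a numerical
   optimisation; the cosine frequencies 2, 3, 6 times 7 pi / (6 (N + 1)) are
   chosen so that the Dirichlet kernel of [1 .. N] is very negative there. *)
Definition w2 : R := 1722 / 10000.
Definition w3 : R := 96 / 1000.
Definition w6 : R := 175 / 10000.

(** Since the estimate behind [missing_term] is valid for every positive [q], the three values may
    depend on [u]. [P] is the weighted cost of one missing value after the shares are paid. *)
Definition missing_bounded (s2 s3 s6 P : R) : Prop := forall u, -1 <= u -> u <= 1 ->
  exists q2 q3 q6, 0 < q2 /\ 0 < q3 /\ 0 < q6 /\
  w2 * missing_term s2 q2 (cheb2 u) + w3 * missing_term s3 q3 (cheb3 u) +
  w6 * missing_term s6 q6 (cheb6 u) <= P.

Definition adjacent_bounded (s2 s3 s6 P : R) : Prop := forall u, -1 <= u -> u <= 1 ->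
  exists q2 q3 q6, 0 < q2 /\ 0 < q3 /\ 0 < q6 /\
  w2 * adjacent_term s2 q2 (cheb2 u) + w3 * adjacent_term s3 q3 (cheb3 u) +
  w6 * adjacent_term s6 q6 (cheb6 u) <= P.

(** Together with those of [adjacent_bound_high], these shares nearly exhaust what [freq_ok] allows
    for [c = 43], the case [m = 40]; the two [low] lemmas do so for [c = 40], the case [m = 37]. *)
Lemma missing_bound_high : missing_bounded (189 / 100) (49 / 25) (39 / 25) (27 / 100).
Proof.
move=> u lu ur; rewrite /missing_term /adjacent_term /w2 /w3 /w6.
have b2 := cheb2_bound lu ur; have b3 := cheb3_bound lu ur.
have b6 := cheb6_bound lu ur.
have [?|?] := Rlt_le_dec u (-200 / 1000).
  (* For fixed [q] the terms are affine in the Chebyshev values. The integers passed to [cheb_ge0]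
     are 100000 times the coefficients of the slack, rounded; [b2], [b3] and [b6] absorb the
     rounding. *)
  exists (54 / 25), (297 / 100), (283 / 100); do 3 (split; first lra).
  have := @cheb_ge0 4 (-1000) (-200) 1000 915 4305 6529 1571 u
    ltac:(lra) isT ltac:(lra); lra.
have [?|?] := Rlt_le_dec u (312 / 1000).
  exists (28 / 25), (46 / 25), (253 / 100); do 3 (split; first lra).
  have := @cheb_ge0 0 (-200) 312 1000 (-20490) (-23678) (-1252) 1342 u
    ltac:(lra) isT ltac:(lra); lra.
have [?|?] := Rlt_le_dec u (608 / 1000).
  exists (167 / 100), (53 / 50), (303 / 100); do 3 (split; first lra).
  have := @cheb_ge0 0 312 608 1000 (-17433) (-4537) (-16302) 1698 u
    ltac:(lra) isT ltac:(lra); lra.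
exists (68 / 25), (29 / 20), (131 / 50); do 3 (split; first lra).
(* The certified interval is half-open, so its right end lies beyond 1 in order to include
   [u = 1]. *)
have := @cheb_ge0 2 608 1001 1000 (-3657) 10509 (-6753) 1416 u
  ltac:(lra) isT ltac:(lra); lra.
Qed.

Lemma adjacent_bound_high : adjacent_bounded (101 / 100) (4 / 5) (39 / 100) (3 / 20).
Proof.
move=> u lu ur; rewrite /missing_term /adjacent_term /w2 /w3 /w6.
have b2 := cheb2_bound lu ur; have b3 := cheb3_bound lu ur.
have b6 := cheb6_bound lu ur.
have [?|?] := Rlt_le_dec u (-728 / 1000).
  exists (121 / 100), (27 / 25), (117 / 100); do 3 (split; first lra).
  have := @cheb_ge0 0 (-1000) (-728) 1000 1603 (-2846) (-2489) (-1167) u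
    ltac:(lra) isT ltac:(lra); lra.
have [?|?] := Rlt_le_dec u (896 / 1000).
  exists (127 / 100), (19 / 20), (117 / 100); do 3 (split; first lra).
  have := @cheb_ge0 3 (-728) 896 1000 1392 (-3525) (-1516) (-1167) u
    ltac:(lra) isT ltac:(lra); lra.
exists (7 / 10), (47 / 50), (63 / 50); do 3 (split; first lra).
have := @cheb_ge0 0 896 1001 1000 (-4910) 7626 (-1430) (-1208) u
  ltac:(lra) isT ltac:(lra); lra.
Qed.

Lemma missing_bound_low : missing_bounded (183 / 100) (91 / 50) (143 / 100) (143 / 500).
Proof.
move=> u lu ur; rewrite /missing_term /adjacent_term /w2 /w3 /w6.
have b2 := cheb2_bound lu ur; have b3 := cheb3_bound lu ur.
have b6 := cheb6_bound lu ur.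
have [?|?] := Rlt_le_dec u (-164 / 1000).
  exists (52 / 25), (139 / 50), (109 / 50); do 3 (split; first lra).
  have := @cheb_ge0 0 (-1000) (-164) 1000 1453 4139 6630 1204 u
    ltac:(lra) isT ltac:(lra); lra.
have [?|?] := Rlt_le_dec u (308 / 1000).
  exists (117 / 100), (87 / 50), (279 / 100); do 3 (split; first lra).
  have := @cheb_ge0 0 (-164) 308 1000 (-16929) (-19428) (-883) 1706 u
    ltac:(lra) isT ltac:(lra); lra.
have [?|?] := Rlt_le_dec u (580 / 1000).
  exists (39 / 25), (11 / 10), (72 / 25); do 3 (split; first lra).
  have := @cheb_ge0 0 308 580 1000 (-15451) (-5961) (-12567) 1762 u
    ltac:(lra) isT ltac:(lra); lra.
exists (66 / 25), (67 / 50), (263 / 100); do 3 (split; first lra).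
have := @cheb_ge0 2 580 1001 1000 (-3550) 10567 (-6878) 1597 u
  ltac:(lra) isT ltac:(lra); lra.
Qed.

Lemma adjacent_bound_low : adjacent_bounded (87 / 100) (3 / 4) (19 / 50) (21 / 125).
Proof.
move=> u lu ur; rewrite /missing_term /adjacent_term /w2 /w3 /w6.
have b2 := cheb2_bound lu ur; have b3 := cheb3_bound lu ur.
have b6 := cheb6_bound lu ur.
have [?|?] := Rlt_le_dec u (912 / 1000).
  exists (111 / 100), (103 / 100), (23 / 20); do 3 (split; first lra).
  have := @cheb_ge0 4 (-1000) 912 1000 2358 (-3723) (-2610) (-1172) u
    ltac:(lra) isT ltac:(lra); lra.
exists (59 / 100), (83 / 100), (59 / 50); do 3 (split; first lra).
have := @cheb_ge0 0 912 1001 1000 (-5975) 8172 (-925) (-1186) u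
  ltac:(lra) isT ltac:(lra); lra.
Qed.

(* The diagonal terms [cheb_k(u)^2] of the squared cosine sums are charged to
   the vertices. *)
Definition gain (u : R) : R :=
  281 / 100 * cheb2 u - 177 / 100 * cheb3 u + 276 / 1000 * cheb6 u
  - w2 * cheb2 u ^ 2 - w3 * cheb3 u ^ 2 - w6 * cheb6 u ^ 2.

Definition gain_poly (g : Z) : list Z :=
  [:: -32757 - g; 53100; 110428; -70800; -189828; 0; 386560; 0; -604800; 0;
      537600; 0; -179200]%Z.

Lemma peval_gain g u : peval (gain_poly g) u = 10000 * gain u - IZR g.
Proof.
cbn [peval gain_poly]; rewrite minus_IZR /gain /cheb6 /cheb2 /cheb3 /w2 /w3 /w6.
by field.
Qed.

Lemma gain_ge fuel l r g u : pos_check fuel l r 1000 (gain_poly g) ->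
  IZR l <= 1000 * u < IZR r -> IZR g <= 10000 * gain u.
Proof.
move=> chk lur; have := @pos_check_sound fuel l r 1000 _ u ltac:(lra) chk lur.
by rewrite peval_gain; lra.
Qed.

(** The threshold lies just below [cos(7 pi / 24)], the extreme cosine for values in [[0, N/2]]. *)
Lemma gain_main u : 608 / 1000 <= u <= 1 -> 997 / 1000 <= gain u.
Proof.
by move=> ul; have := @gain_ge 2 608 1001 9970 u isT ltac:(lra); lra.
Qed.

(** The threshold lies just below [cos(3 pi / 8)], which bounds the cosine at a value up to
    [4(N + 1)/7]. *)
Lemma gain_outlier u : 382 / 1000 <= u <= 1 -> - (34 / 100) <= gain u.
Proof.
by move=> ul; have := @gain_ge 0 382 1001 (-3400) u isT ltac:(lra); lra.
Qed.

Local Close Scope R_scope.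

(** * The energy inequality *)

Section PairSums.
Variables (T : finType) (e : rel T) (a : T -> nat) (A : {set T}) (N : nat).
Hypotheses (e_sym : symmetric e) (aA : almost_sidon e a N A).

Definition adj_pairs : {set T * T} :=
  [set p in setX A A | (p.1 != p.2) && e p.1 p.2].

Definition far_set : {set T * T} :=
  [set p in setX A A | (p.1 != p.2) && ~~ e p.1 p.2].

Definition pair_sum (p : T * T) : nat := a p.1 + a p.2.

Definition hit (v : nat) : bool := [exists p in far_set, pair_sum p == v].

(** By the Sidon condition a value that is hit comes from one unordered pair, that is from two
    ordered ones. *)
Lemma card_fiber v : #|[set p in far_set | pair_sum p == v]| = (hit v).*2.
Proof.
case: (boolP (hit v)) => [/existsP[[x y]]|]; last first.
  rewrite negb_exists => /forallP h; apply: eq_card0 => p.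
  by rewrite [LHS]inE; apply/negbTE/(h p).
rewrite !inE /= => /andP[/and3P[/andP[xA yA] xy nxy] /eqP <-].
rewrite (_ : [set _ in _ | _] = [set (x, y); (y, x)]).
  by rewrite cards2 xpair_eqE (negPf xy).
apply/setP => -[x' y']; rewrite !inE /=; apply/idP/idP.
  move=> /andP[/and3P[/andP[xA' yA'] xy' nxy'] /eqP s].
  by have [->|->] := aA.2 _ _ xA' yA' _ _ xA yA xy' nxy' xy nxy s; rewrite eqxx ?orbT.
by case/orP => /eqP[-> ->]; rewrite ?xA ?yA ?[y == x]eq_sym ?xy ?[e y x]e_sym
  ?nxy /pair_sum //= addnC.
Qed.

(** Stated for an arbitrary commutative law because it serves both for counting, with [addn], and
    for real sums. *)
Lemma big_far_set (S : Type) (idx : S) (op : Monoid.com_law idx) (g : nat -> S) :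
  \big[op/idx]_(p in far_set) g (pair_sum p) =
  \big[op/idx]_(v <- iota 1 N | hit v) op (g v) (g v).
Proof.
transitivity (\big[op/idx]_(p in far_set)
    \big[op/idx]_(v <- iota 1 N | v == pair_sum p) g v).
  apply: eq_bigr => -[x y]; rewrite !inE /= => /and3P[/andP[xA yA] xy nxy].
  have xyN : pair_sum (x, y) \in iota 1 N.
    by rewrite mem_iota; have := aA.1 _ _ xA yA xy nxy; rewrite /pair_sum /=; lia.
  rewrite big_mkcond (bigD1_seq _ xyN (iota_uniq _ _)) /= eqxx.
  by rewrite big1 ?Monoid.mulm1 // => v /negPf->.
rewrite (exchange_big_dep predT) //= [RHS]big_mkcond; apply: eq_bigr => v _.
rewrite (eq_bigl (fun p => p \in [set q in far_set | pair_sum q == v])).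
  by rewrite big_const card_fiber; case: (hit v) => //=; rewrite Monoid.mulm1.
by move=> p; rewrite [v == _]eq_sym [RHS]inE.
Qed.

Lemma big_setX_split (S : Type) (idx : S) (op : Monoid.com_law idx) (g : nat -> S) :
  \big[op/idx]_(x in A) \big[op/idx]_(y in A) g (a x + a y) =
  op (\big[op/idx]_(x in A) g (2 * a x))
    (op (\big[op/idx]_(p in adj_pairs) g (pair_sum p))
        (\big[op/idx]_(p in far_set) g (pair_sum p))).
Proof.
under eq_bigr => x xA do rewrite (bigD1 x xA) /= addnn -mul2n.
rewrite big_split /= pair_big_dep [X in op _ X = _](bigID (fun p => e p.1 p.2)) /=.
by congr (op _ (op _ _)); apply: eq_bigl => p; rewrite !inE [p.2 == _]eq_sym -!andbA.
Qed.

Lemma pair_sum_identity m :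
  N = (m * (m + 3))./2 -> #|A| = m.+1 -> #|adj_pairs| <= 2 * m ->
  exists2 M : seq nat, size M <= 2 * m & forall g : nat -> R,
  \big[Rplus/0%Re]_(x in A) \big[Rplus/0%Re]_(y in A) g (a x + a y) =
  (\big[Rplus/0%Re]_(x in A) g (2 * a x)%N
   + \big[Rplus/0%Re]_(p in adj_pairs) g (pair_sum p)
   + 2 * (\big[Rplus/0%Re]_(v <- iota 1 N) g v - \big[Rplus/0%Re]_(v <- M) g v))%Re.
Proof.
move=> NE cA cE; exists [seq v <- iota 1 N | ~~ hit v].
  (* Counting ordered pairs gives [(m+1)^2 = (m+1) + #|adj_pairs| + 2 c1] with [c1] hit values, so
     at most [2m] of the [N] values are missed. *)
  have /= := big_setX_split addn (fun=> 1).
  have /= -> := big_far_set addn (fun=> 1).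
  rewrite big_split /= !sum_nat_const cA ?muln1 !sum1_count.
  have := count_predC hit (iota 1 N); rewrite size_iota size_filter.
  set c1 := count hit _; set c2 := count _ _; set E := #|_| in cE *; nia.
move=> g; rewrite big_setX_split big_far_set big_split /= big_filter.
by rewrite [X in (X - _)%Re](bigID hit) /=; ring.
Qed.

End PairSums.

(** * Real sums and trigonometric identities *)

Local Open Scope R_scope.
Local Notation "\rsum_ ( i <- r ) F" := (\big[Rplus/0]_(i <- r) F)
  (at level 41, F at level 41, i, r at level 50).
Local Notation "\rsum_ ( i 'in' A ) F" := (\big[Rplus/0]_(i in A) F)
  (at level 41, F at level 41, i, A at level 50).

Lemma rsum_opp I (r : seq I) (P : pred I) (f : I -> R) :
  \big[Rplus/0]_(i <- r | P i) (- f i) = - \big[Rplus/0]_(i <- r | P i) f i.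
Proof.
rewrite (_ : - _ = -1 * \big[Rplus/0]_(i <- r | P i) f i); last by ring.
by rewrite big_distrr /=; apply: eq_bigr => i _; ring.
Qed.

Lemma rsum_le I (r : seq I) (P : pred I) (f g : I -> R) :
  (forall i, P i -> f i <= g i) ->
  \big[Rplus/0]_(i <- r | P i) f i <= \big[Rplus/0]_(i <- r | P i) g i.
Proof. by move=> fg; apply: (big_ind2 Rle) => // *; lra. Qed.

Lemma rsum_const I (r : seq I) (P : pred I) (c : R) :
  \big[Rplus/0]_(i <- r | P i) c = INR (count P r) * c.
Proof.
elim: r => [|i r IH]; first by rewrite big_nil /=; ring.
rewrite big_cons [count _ _]/= IH; case: (P i).
  by rewrite add1n S_INR; ring.
by rewrite add0n.
Qed.

Lemma rsum_le_const I (r : seq I) (P : pred I) (f : I -> R) (c : R) :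
  (forall i, P i -> f i <= c) ->
  \big[Rplus/0]_(i <- r | P i) f i <= INR (count P r) * c.
Proof. by move=> fc; rewrite -rsum_const; apply: rsum_le. Qed.

(** With [F = C + i S], take [(p, r)] to be the direction of [F^2]: the right side is [Re F^2 +
    |F^2| = (C^2 - S^2) + (C^2 + S^2)]. If [F = 0], any unit vector serves. *)
Lemma cos_sum_sqr (T : finType) (A : {set T}) (b : T -> R) :
  exists p r, p ^ 2 + r ^ 2 = 1 /\
  2 * (\rsum_(x in A) cos (b x)) ^ 2 =
  \rsum_(x in A) \rsum_(y in A) ((1 + p) * cos (b x + b y) + r * sin (b x + b y)).
Proof.
set C := \rsum_(x in A) _; pose S := \rsum_(x in A) sin (b x).
have sumE p r : \rsum_(x in A) \rsum_(y in A)
    ((1 + p) * cos (b x + b y) + r * sin (b x + b y)) =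
    (1 + p) * (C ^ 2 - S ^ 2) + r * (2 * C * S).
  transitivity ((1 + p) * (C * C) + - ((1 + p) * (S * S)) + r * (S * C)
    + r * (C * S)); last by ring.
  rewrite /C /S !big_distrlr !big_distrr /= -rsum_opp -!big_split /=.
  apply: eq_bigr => x _; rewrite !big_distrr /= -rsum_opp -!big_split /=.
  by apply: eq_bigr => y _; rewrite cos_plus sin_plus; ring.
have [R0|Rn0] := Req_dec (C ^ 2 + S ^ 2) 0.
  have C0 : C = 0 by nra.
  have S0 : S = 0 by nra.
  by exists 1, 0; rewrite sumE C0 S0; split; ring.
exists ((C ^ 2 - S ^ 2) / (C ^ 2 + S ^ 2)), (2 * C * S / (C ^ 2 + S ^ 2)).
by rewrite sumE; split; field.
Qed.

Lemma iotaSr N : iota 1 N.+1 = iota 1 N ++ [:: N.+1].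
Proof. by rewrite -[X in iota 1 X]addn1 iotaD add1n. Qed.

(** The product formula for [2 sin(t/2) cos(z)] makes the sum telescope. *)
Lemma cos_progression N t c :
  2 * sin (t / 2) * (\rsum_(v <- iota 1 N) cos (t * INR v + c)) =
  sin (t * INR N + c + t / 2) - sin (c + t / 2).
Proof.
elim: N => [|N IH]; first by rewrite big_nil /= !Rmult_0_r Rplus_0_l; ring.
rewrite iotaSr big_cat big_seq1 Rmult_plus_distr_l IH S_INR.
rewrite (_ : t * (INR N + 1) + c = (t * INR N + c + t / 2) + t / 2); last by field.
move: (t * INR N + c + t / 2) => z.
rewrite cos_plus (sin_plus (z + t / 2)) (sin_plus z) (cos_plus z).
apply: Rminus_diag_uniq.
transitivity (sin z * (1 - (Rsqr (sin (t / 2)) + Rsqr (cos (t / 2))))).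
  by rewrite /Rsqr; ring.
by rewrite sin2_cos2; ring.
Qed.

Lemma sin_progression N t c :
  2 * sin (t / 2) * (\rsum_(v <- iota 1 N) sin (t * INR v + c)) =
  cos (c + t / 2) - cos (t * INR N + c + t / 2).
Proof.
elim: N => [|N IH]; first by rewrite big_nil /= !Rmult_0_r Rplus_0_l; ring.
rewrite iotaSr big_cat big_seq1 Rmult_plus_distr_l IH S_INR.
rewrite (_ : t * (INR N + 1) + c = (t * INR N + c + t / 2) + t / 2); last by field.
move: (t * INR N + c + t / 2) => z.
rewrite (sin_plus z) (cos_plus (z + t / 2)) (sin_plus z) (cos_plus z).
apply: Rminus_diag_uniq.
transitivity (cos z * (Rsqr (sin (t / 2)) + Rsqr (cos (t / 2)) - 1)).
  by rewrite /Rsqr; ring.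
by rewrite sin2_cos2; ring.
Qed.

Lemma cos_cheb2 x : cos (2 * x) = cheb2 (cos x).
Proof. by rewrite cos_2a_cos /cheb2; ring. Qed.

Lemma cos_cheb3 x : cos (3 * x) = cheb3 (cos x).
Proof.
rewrite (_ : 3 * x = 2 * x + x); last by ring.
rewrite cos_plus cos_2a_cos sin_2a /cheb3.
have := sin2_cos2 x; rewrite /Rsqr => sc.
transitivity (2 * cos x * cos x * cos x - cos x - 2 * cos x * (sin x * sin x)).
  by ring.
by rewrite (_ : sin x * sin x = 1 - cos x * cos x); [ring | lra].
Qed.

Lemma cos_cheb6 x : cos (6 * x) = cheb6 (cos x).
Proof.
rewrite (_ : 6 * x = 2 * (3 * x)); last by ring.
by rewrite cos_cheb2 cos_cheb3.
Qed.

(** Expand the squared length of [(x, y) - q (p, r)], which is non-negative. *)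
Lemma unit_dot_le p r x y q : p ^ 2 + r ^ 2 = 1 -> 0 < q ->
  p * x + r * y <= (x ^ 2 + y ^ 2 + q ^ 2) / (2 * q).
Proof.
move=> pr q0; apply: (Rmult_le_reg_r (2 * q)); first lra.
rewrite /Rdiv Rmult_assoc Rinv_l; last lra.
have := pow2_ge_0 (x - q * p); have := pow2_ge_0 (y - q * r); nra.
Qed.

Lemma missing_term_ge p r s q z : p ^ 2 + r ^ 2 = 1 -> 0 < q ->
  - 2 * ((1 + p) * cos z + r * sin z) - (1 + p) * s <= missing_term s q (cos z).
Proof.
move=> pr q0; have := unit_dot_le (- 2 * cos z - s) (- 2 * sin z) pr q0.
rewrite /missing_term (_ : (_ - s) ^ 2 + _ = 4 + 4 * cos z * s + s ^ 2); first lra.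
have := sin2_cos2 z; rewrite /Rsqr => sc.
transitivity (4 * (sin z * sin z + cos z * cos z) + 4 * cos z * s + s ^ 2).
  by ring.
by rewrite sc; ring.
Qed.

Lemma adjacent_term_ge p r s q z : p ^ 2 + r ^ 2 = 1 -> 0 < q ->
  (1 + p) * cos z + r * sin z - (1 + p) * s <= adjacent_term s q (cos z).
Proof.
move=> pr q0; have := unit_dot_le (cos z - s) (sin z) pr q0.
rewrite /adjacent_term (_ : (_ - s) ^ 2 + _ = 1 - 2 * cos z * s + s ^ 2); first lra.
have := sin2_cos2 z; rewrite /Rsqr => sc.
transitivity ((sin z * sin z + cos z * cos z) - 2 * cos z * s + s ^ 2).
  by ring.
by rewrite sc; ring.
Qed.

Lemma unit_p_ge p r : p ^ 2 + r ^ 2 = 1 -> 0 <= 1 + p.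
Proof. by move=> pr; nra. Qed.

Lemma rsum_affine I (r : seq I) (P : pred I) (f2 f3 f6 : I -> R) (c c2 c3 c6 : R) :
  \big[Rplus/0]_(i <- r | P i) (c2 * f2 i + c3 * f3 i + c6 * f6 i + c) =
  c2 * (\big[Rplus/0]_(i <- r | P i) f2 i) + c3 * (\big[Rplus/0]_(i <- r | P i) f3 i)
  + c6 * (\big[Rplus/0]_(i <- r | P i) f6 i) + INR (count P r) * c.
Proof. by rewrite !big_split /= rsum_const !big_distrr. Qed.

(** Completing the square replaces the squared cosine sums by linear ones, which can be bounded
    vertex by vertex. *)
Lemma square_ge w al c : 0 < w -> al * c <= w * c ^ 2 + al ^ 2 / (4 * w).
Proof.
move=> w0; suff : 0 <= w * c ^ 2 + al ^ 2 / (4 * w) - al * c by lra.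
rewrite (_ : _ - _ = (2 * w * c - al) ^ 2 / (4 * w)); last by field; lra.
apply: Rmult_le_pos; first exact: pow2_ge_0.
by apply/Rlt_le/Rinv_0_lt_compat; lra.
Qed.

Section Energy.
Variables (T : finType) (e : rel T) (a : T -> nat) (A : {set T}) (N m : nat).
Variable M : seq nat.
Local Notation E := (adj_pairs e A).
Hypothesis identity : forall g : nat -> R,
  \rsum_(x in A) \rsum_(y in A) g (a x + a y)%N =
  \rsum_(x in A) g (2 * a x)%N + \rsum_(p in E) g (pair_sum a p)
  + 2 * (\rsum_(v <- iota 1 N) g v - \rsum_(v <- M) g v).

(** Centred at the midpoint of [1 .. N]. In [vertex_angle] the shift is halved, so that the phase of
    [a x + a y] is the sum of the two vertex angles. *)
Definition phase (t : R) (v : nat) : R := t * (INR v - (INR N + 1) / 2).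
Definition vertex_angle (t : R) (x : T) : R := t * (INR (a x) - (INR N + 1) / 4).

Definition tone (p r t : R) (v : nat) : R :=
  (1 + p) * cos (phase t v) + r * sin (phase t v).

(** By symmetry about the centre the sines cancel, and the cosines sum to the Dirichlet kernel
    [sin(tN/2) / sin(t/2)], which is at most [D]. *)
Lemma tone_iota p r t D :
  0 < sin (t / 2) -> sin (t * INR N / 2) <= D * sin (t / 2) ->
  0 <= 1 + p -> \rsum_(v <- iota 1 N) tone p r t v <= (1 + p) * D.
Proof.
move=> s0 hD p0; pose c := - t * ((INR N + 1) / 2).
have phE v : phase t v = t * INR v + c by rewrite /phase /c; ring.
have sumE : \rsum_(v <- iota 1 N) tone p r t v =
    (1 + p) * (\rsum_(v <- iota 1 N) cos (t * INR v + c)) +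
    r * (\rsum_(v <- iota 1 N) sin (t * INR v + c)).
  by rewrite !big_distrr -big_split; apply: eq_bigr => v _; rewrite /tone phE.
have e1 : t * INR N + c + t / 2 = t * INR N / 2 by rewrite /c; field.
have e2 : c + t / 2 = - (t * INR N / 2) by rewrite /c; field.
have cE := cos_progression N t c; have sE := sin_progression N t c.
rewrite e1 e2 sin_neg in cE; rewrite e1 e2 cos_neg in sE.
rewrite sumE; set X := \rsum_(v <- _) _ in cE *; set Y := \rsum_(v <- _) _ in sE *.
have -> : Y = 0 by nra.
have : X <= D by nra.
by nra.
Qed.

Lemma energy_bound t D :
  0 < sin (t / 2) -> sin (t * INR N / 2) <= D * sin (t / 2) ->
  exists p r, p ^ 2 + r ^ 2 = 1 /\
  (\rsum_(x in A) cos (vertex_angle t x)) ^ 2 <=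
  \rsum_(x in A) cos (vertex_angle t x) ^ 2 +
  / 2 * (\rsum_(p' in E) tone p r t (pair_sum a p')) + (1 + p) * D
  - \rsum_(v <- M) tone p r t v.
Proof.
move=> s0 hD; have [p [r [pr cE]]] := cos_sum_sqr A (vertex_angle t).
exists p, r; split=> //.
have p0 := unit_p_ge pr.
have hi := @tone_iota p r t D s0 hD p0.
(* On the diagonal [p cos(2z) + r sin(2z) <= 1], and [1 + cos(2z) = 2 cos(z)^2]. *)
have dE : \rsum_(x in A) tone p r t (2 * a x) <=
    2 * \rsum_(x in A) cos (vertex_angle t x) ^ 2.
  rewrite big_distrr /=; apply: rsum_le => x _; rewrite /tone.
  rewrite (_ : phase t _ = 2 * vertex_angle t x); last first.
    by rewrite /phase /vertex_angle mult_INR /=; field.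
  move: (vertex_angle t x) => z.
  have := unit_dot_le (cos (2 * z)) (sin (2 * z)) pr Rlt_0_1.
  rewrite (_ : (_ + _ + _) / _ = 1); last first.
    by have := sin2_cos2 (2 * z); rewrite /Rsqr; lra.
  by have := cos_2a_cos z; lra.
have := identity (tone p r t).
rewrite (_ : \rsum_(x in A) \rsum_(y in A) _ =
  2 * (\rsum_(x in A) cos (vertex_angle t x)) ^ 2); first by lra.
rewrite cE; apply: eq_bigr => x _; apply: eq_bigr => y _; rewrite /tone.
rewrite (_ : phase t _ = vertex_angle t x + vertex_angle t y) //.
by rewrite /phase /vertex_angle plus_INR; field.
Qed.

Hypothesis size_M : (size M <= 2 * m)%N.
Hypothesis card_E : (#|E| <= 2 * m)%N.

(** At each frequency the kernel term is at most [-(1 + p) m (s + z)]. This pays the shares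
    [(1 + p) s] and [(1 + p) z] of up to [2m] missing values and [2m] ordered adjacent pairs, each
    entering with factor 1/2. What remains is [m (P + Q)] and the constant from [square_ge]. *)
Lemma gain_sum t s2 s3 s6 P z2 z3 z6 Q :
  missing_bounded s2 s3 s6 P -> adjacent_bounded z2 z3 z6 Q ->
  0 <= P -> 0 <= s2 -> 0 <= s3 -> 0 <= s6 ->
  0 <= Q -> 0 <= z2 -> 0 <= z3 -> 0 <= z6 ->
  (forall k s, List.In (k, s) [:: (2, s2 + z2); (3, s3 + z3); (6, s6 + z6)] ->
    0 < sin (k * t / 2) /\
    sin (k * t * INR N / 2) <= - (INR m * s) * sin (k * t / 2)) ->
  \rsum_(x in A) gain (cos (vertex_angle t x)) <= 2072 / 100 + INR m * (P + Q).
Proof.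
move=> miss adj P0 s20 s30 s60 Q0 z20 z30 z60 freq.
have [sin2 D2] : _ := freq 2 (s2 + z2) ltac:(by left).
have [sin3 D3] : _ := freq 3 (s3 + z3) ltac:(by right; left).
have [sin6 D6] : _ := freq 6 (s6 + z6) ltac:(by do 2 right; left).
have [p2 [r2 [u2 C2]]] := energy_bound sin2 D2.
have [p3 [r3 [u3 C3]]] := energy_bound sin3 D3.
have [p6 [r6 [u6 C6]]] := energy_bound sin6 D6.
have phaseM k v : phase (k * t) v = k * phase t v by rewrite /phase; ring.
have angleM k x : vertex_angle (k * t) x = k * vertex_angle t x.
  by rewrite /vertex_angle; ring.
have cos_lo v : -1 <= cos (phase t v) by exact: (proj1 (COS_bound _)).
have cos_hi v : cos (phase t v) <= 1 by exact: (proj2 (COS_bound _)).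
have mSize : INR (size M) <= 2 * INR m.
  by have := le_INR _ _ (leP size_M); rewrite mult_INR.
have eSize : INR #|E| <= 2 * INR m.
  by have := le_INR _ _ (leP card_E); rewrite mult_INR.
have hM : \rsum_(v <- M) (- 2 * w2 * tone p2 r2 (2 * t) v
    + - 2 * w3 * tone p3 r3 (3 * t) v + - 2 * w6 * tone p6 r6 (6 * t) v
    + - (w2 * (1 + p2) * s2 + w3 * (1 + p3) * s3 + w6 * (1 + p6) * s6)) <=
    INR (size M) * P.
  rewrite -(count_predT M); apply: rsum_le_const => v _.
  have [q2 [q3 [q6 [h2 [h3 [h6]]]]]] := miss _ (cos_lo v) (cos_hi v).
  rewrite -cos_cheb2 -cos_cheb3 -cos_cheb6 -!phaseM.
  have := missing_term_ge s2 (phase (2 * t) v) u2 h2.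
  have := missing_term_ge s3 (phase (3 * t) v) u3 h3.
  have := missing_term_ge s6 (phase (6 * t) v) u6 h6.
  by rewrite /tone /w2 /w3 /w6; lra.
have hE : \rsum_(p in E) (w2 * tone p2 r2 (2 * t) (pair_sum a p)
    + w3 * tone p3 r3 (3 * t) (pair_sum a p)
    + w6 * tone p6 r6 (6 * t) (pair_sum a p)
    + - (w2 * (1 + p2) * z2 + w3 * (1 + p3) * z3 + w6 * (1 + p6) * z6)) <=
    INR #|E| * Q.
  rewrite -sum1_card sum1_count; apply: rsum_le_const => p _.
  move: (pair_sum a p) => v.
  have [q2 [q3 [q6 [h2 [h3 [h6]]]]]] := adj _ (cos_lo v) (cos_hi v).
  rewrite -cos_cheb2 -cos_cheb3 -cos_cheb6 -!phaseM.
  have := adjacent_term_ge z2 (phase (2 * t) v) u2 h2.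
  have := adjacent_term_ge z3 (phase (3 * t) v) u3 h3.
  have := adjacent_term_ge z6 (phase (6 * t) v) u6 h6.
  by rewrite /tone /w2 /w3 /w6; lra.
rewrite rsum_affine count_predT in hM.
rewrite rsum_affine -sum1_count sum1_card in hE.
have gainE : \rsum_(x in A) gain (cos (vertex_angle t x)) =
    281 / 100 * (\rsum_(x in A) cos (vertex_angle (2 * t) x))
    - 177 / 100 * (\rsum_(x in A) cos (vertex_angle (3 * t) x))
    + 276 / 1000 * (\rsum_(x in A) cos (vertex_angle (6 * t) x))
    - w2 * (\rsum_(x in A) cos (vertex_angle (2 * t) x) ^ 2)
    - w3 * (\rsum_(x in A) cos (vertex_angle (3 * t) x) ^ 2)
    - w6 * (\rsum_(x in A) cos (vertex_angle (6 * t) x) ^ 2).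
  rewrite !big_distrr /= /Rminus -!rsum_opp -!big_split /=; apply: eq_bigr => x _.
  by rewrite !angleM cos_cheb2 cos_cheb3 cos_cheb6.
rewrite gainE.
(* The three values [al^2 / (4 w)] add up to slightly less than 20.72. *)
have c2 := @square_ge w2 (281 / 100) (\rsum_(x in A) cos (vertex_angle (2 * t) x)).
have c3 := @square_ge w3 (- (177 / 100)) (\rsum_(x in A) cos (vertex_angle (3 * t) x)).
have c6 := @square_ge w6 (276 / 1000) (\rsum_(x in A) cos (vertex_angle (6 * t) x)).
have cmp p r s n : p ^ 2 + r ^ 2 = 1 -> 0 <= s -> n <= 2 * INR m ->
    (1 + p) * s * n <= (1 + p) * s * (2 * INR m).
  move=> /unit_p_ge p0 s0 nm; apply: Rmult_le_compat_l => //.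
  exact: Rmult_le_pos.
have m2 := cmp _ _ _ _ u2 s20 mSize; have m3 := cmp _ _ _ _ u3 s30 mSize.
have m6 := cmp _ _ _ _ u6 s60 mSize.
have e2 := cmp _ _ _ _ u2 z20 eSize; have e3 := cmp _ _ _ _ u3 z30 eSize.
have e6 := cmp _ _ _ _ u6 z60 eSize.
have mP := Rmult_le_compat_r _ _ _ P0 mSize.
have eQ := Rmult_le_compat_r _ _ _ Q0 eSize.
move: (c2 ltac:(rewrite /w2; lra)) (c3 ltac:(rewrite /w3; lra)) (c6 ltac:(rewrite /w6; lra)).
rewrite /w2 /w3 /w6 in hM hE *.
lra.
Qed.

End Energy.

(** * Bounds for almost Sidon sets *)

(** Three terms of the alternating series in the Machin-type formula
    [pi/4 = 2 arctan(1/3) + arctan(1/7)]. *)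
Lemma PI_le_22_7 : PI <= 22 / 7.
Proof.
have [_] := PI_2_3_7_ineq 1.
rewrite /tg_alt /PI_2_3_7_tg /Ratan_seq /sum_f_R0 /= => h.
by lra.
Qed.

Lemma cos_ge_1_sub x : 0 < x -> 1 - x ^ 2 / 2 <= cos x.
Proof.
move=> x0; rewrite (_ : x = 2 * (x / 2)); last by field.
rewrite cos_2a_sin.
have [x4|x4] := Rle_lt_dec (x / 2) 1.
  have := sin_lt_x (x / 2) ltac:(lra).
  have := sin_gt_0 (x / 2) ltac:(lra) ltac:(have := PI2_1; lra).
  by nra.
by have := SIN_bound (x / 2); nra.
Qed.

Lemma cos_ge_cos b x : 0 <= b <= PI -> - b <= x <= b -> cos b <= cos x.
Proof.
move=> b0 xb; have [x0|x0] := Rle_lt_dec 0 x; first by apply: cos_decr_1; lra.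
by rewrite -(cos_neg x); apply: cos_decr_1; lra.
Qed.

Lemma sqrt_bounds c l r : 0 < l -> 0 < r -> l ^ 2 <= c <= r ^ 2 -> l <= sqrt c <= r.
Proof.
move=> l0 r0 [lc cr].
have := sqrt_le_1_alt _ _ lc; have := sqrt_le_1_alt _ _ cr.
by rewrite !sqrt_pow2; lra.
Qed.

Lemma sqrt2_bounds : 141421 / 100000 <= sqrt 2 <= 141422 / 100000.
Proof. by apply: sqrt_bounds; lra. Qed.

Lemma sqrt3_bounds : 173205 / 100000 <= sqrt 3 <= 173206 / 100000.
Proof. by apply: sqrt_bounds; lra. Qed.

Lemma inv_sqrt2E : 1 / sqrt 2 = sqrt 2 / 2.
Proof.
have s0 := sqrt_lt_R0 2 ltac:(lra); have := sqrt_sqrt 2 ltac:(lra).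
by move=> s2; apply: (Rmult_eq_reg_r (sqrt 2)); [field_simplify; lra | lra].
Qed.

Lemma cos_7PI24_ge : 608 / 1000 <= cos (7 * PI / 24).
Proof.
have c0 : 0 <= cos (7 * PI / 24) by apply: cos_ge_0; have := PI_RGT_0; lra.
have := cos_2a_cos (7 * PI / 24).
rewrite (_ : 2 * (7 * PI / 24) = PI / 3 + PI / 4); last by field.
rewrite cos_plus cos_PI3 sin_PI3 cos_PI4 sin_PI4 inv_sqrt2E.
have := sqrt2_bounds.
have := sqrt3_bounds.
by nra.
Qed.

Lemma cos_3PI8_ge : 382 / 1000 <= cos (3 * PI / 8).
Proof.
have c0 : 0 <= cos (3 * PI / 8) by apply: cos_ge_0; have := PI_RGT_0; lra.
have := cos_2a_cos (3 * PI / 8).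
rewrite (_ : 2 * (3 * PI / 8) = PI / 2 + PI / 4); last by field.
rewrite cos_plus cos_PI2 sin_PI2 cos_PI4 sin_PI4 inv_sqrt2E.
have := sqrt2_bounds.
by nra.
Qed.

(** After expansion the claim is [(c + sqrt 3 / 2) sin b <= cos b / 2]; the constants round
    [sqrt 3 / 2] up and [cos b / 2] down. The two lemmas that follow work in the same way at the
    other two frequencies. *)
Lemma sin_7PI6_sub b c :
  0 < b < 1 / 100 -> (c + 867 / 1000) * b <= 4999 / 10000 -> 0 <= c ->
  sin (7 * PI / 6 - b) <= - c * sin b.
Proof.
move=> b0 cb c0; rewrite (_ : _ - b = PI / 6 - b + PI); last by field.
rewrite neg_sin sin_minus sin_PI6 cos_PI6.
have := sqrt3_bounds.
have := sin_lt_x b ltac:(lra).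
have := sin_gt_0 b ltac:(lra) ltac:(have := PI2_1; lra).
have := @cos_ge_1_sub b ltac:(lra).
by nra.
Qed.

Lemma sin_7PI4_sub b c : 0 < b < 1 / 100 -> c * b <= 70700 / 100000 -> 0 <= c ->
  sin (7 * PI / 4 - b) <= - c * sin b.
Proof.
move=> b0 cb c0; rewrite (_ : _ - b = - (PI / 4 + b) + 2 * INR 1 * PI);
  last by rewrite /=; field.
rewrite sin_period sin_neg sin_plus sin_PI4 cos_PI4 inv_sqrt2E.
have := sqrt2_bounds.
have := sin_lt_x b ltac:(lra).
have := sin_gt_0 b ltac:(lra) ltac:(have := PI2_1; lra).
have := @cos_ge_1_sub b ltac:(lra).
by nra.
Qed.

Lemma sin_7PI2_sub b c : 0 < b < 1 / 50 -> c * b <= 9997 / 10000 -> 0 <= c ->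
  sin (7 * PI / 2 - b) <= - c * sin b.
Proof.
move=> b0 cb c0; rewrite (_ : _ - b = - (PI / 2 + b) + 2 * INR 2 * PI);
  last by rewrite /=; field.
rewrite sin_period sin_neg sin_plus sin_PI2 cos_PI2.
have := sin_lt_x b ltac:(lra).
have := sin_gt_0 b ltac:(lra) ltac:(have := PI2_1; lra).
have := @cos_ge_1_sub b ltac:(lra).
by nra.
Qed.

Section AlmostSidon.
Variables (T : finType) (e : rel T) (a : T -> nat) (A : {set T}) (m : nat).
Let N := ((m * (m + 3))./2)%N.
Let z := INR N + 1.
Let t := 7 * PI / 6 / z.
Hypotheses (e_sym : symmetric e) (m_gt36 : (36 < m)%N) (cardA : #|A| = m.+1).
Hypothesis aA : almost_sidon e a N A.
Hypothesis card_adj : (#|adj_pairs e A| <= 2 * m)%N.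

Let zE : 2 * z = (INR m + 1) * (INR m + 2).
Proof.
have : (2 * N = m * (m + 3))%N.
  by rewrite mul2n halfK oddM oddD; case: odd; rewrite subn0.
rewrite /z; move: {+}N => n /(congr1 INR); rewrite !mult_INR plus_INR /=.
by lra.
Qed.

Let m_ge37 : 37 <= INR m.
Proof. by have := le_INR _ _ (leP m_gt36); rewrite /=; lra. Qed.

Let z_gt0 : 0 < z.
Proof. by nra. Qed.

(** Uses [7 pi <= 22] and [c m <= m (m + 3) <= 2 z], where [k t / 2 = 7 k pi / (12 z)]. *)
Let half_step_bounds c k : 0 < k -> c <= INR m + 3 -> 0 <= c ->
  0 < k * t / 2 /\ 3 * c * (INR m * (k * t / 2)) <= 11 * k.
Proof.
move=> k0 cm c0; have pi0 := PI_RGT_0; have pi1 := PI_le_22_7.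
have zi := Rinv_0_lt_compat z z_gt0.
rewrite (_ : k * t / 2 = 7 * k * PI / 12 * / z); last by rewrite /t; field; lra.
split; first by apply: Rmult_lt_0_compat => //; nra.
apply: (Rmult_le_reg_r z) => //.
rewrite (_ : _ * z = 21 * c * INR m * k * PI / 12); last by field; lra.
have h1 : 7 * PI <= 22 by lra.
have h2 : c * INR m <= 2 * z by rewrite zE; nra.
have h3 : (c * INR m) * (7 * PI) <= (2 * z) * 22.
  by apply: Rmult_le_compat => //; nra.
by nra.
Qed.

(** With [b = k t / 2] the angle is [7 k pi / 12 - b], where [7 k pi / 12] is [7 pi / 6], [7 pi / 4]
    or [7 pi / 2], with sines [-1/2], [-sqrt 2 / 2] and [-1]. Since [c m b <= 11 k / 3], the
    hypotheses bound [m s b] just below 1/2, [sqrt 2 / 2] and 1. *)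
Lemma freq_ok c s2 s3 s6 : 40 <= c <= INR m + 3 -> 0 <= s2 -> 0 <= s3 -> 0 <= s6 ->
  22 * s2 <= 1486 / 1000 * c -> 11 * s3 <= 707 / 1000 * c ->
  22 * s6 <= 9997 / 10000 * c ->
  forall k s, List.In (k, s) [:: (2, s2); (3, s3); (6, s6)] ->
    0 < sin (k * t / 2) /\
    sin (k * t * INR N / 2) <= - (INR m * s) * sin (k * t / 2).
Proof.
move=> c40 s20 s30 s60 h2 h3 h6.
have angE k : k * t * INR N / 2 = 7 * k * PI / 12 - k * t / 2.
  by rewrite /t (_ : INR N = z - 1); [field; lra | rewrite /z; ring].
have pi2 := PI2_1.
have pos b : 0 < b < 1 -> 0 < sin b by move=> ?; apply: sin_gt_0; lra.
(* Here [4440 = 3 * 40 * 37], from [40 <= c] and [37 <= m]. *)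
have step b k : 0 < b -> 3 * c * (INR m * b) <= 11 * k -> b <= 11 * k / 4440 /\
    c * (INR m * b) <= 11 * k / 3.
  move=> b0 mb; split; last lra.
  have mb0 : 37 * b <= INR m * b by apply: Rmult_le_compat_r; lra.
  have := @Rmult_le_compat_r (INR m * b) 40 c ltac:(lra) ltac:(lra); lra.
move=> k s [[<- <-]|[[<- <-]|[[<- <-]|[]]]]; rewrite angE.
- have [] := @half_step_bounds c 2 ltac:(lra) ltac:(lra) ltac:(lra).
  move: (2 * t / 2) => b b0 mb.
  have mb0 : 0 <= INR m * b by apply: Rmult_le_pos; lra.
  have [b1 cmb] := @step b 2 b0 mb.
  have hs := Rmult_le_compat_r _ _ _ mb0 h2.
  split; first by apply: pos; lra.
  rewrite (_ : 7 * 2 * PI / 12 = 7 * PI / 6); last by field.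
  by apply: sin_7PI6_sub; [lra | nra | nra].
- have [] := @half_step_bounds c 3 ltac:(lra) ltac:(lra) ltac:(lra).
  move: (3 * t / 2) => b b0 mb.
  have mb0 : 0 <= INR m * b by apply: Rmult_le_pos; lra.
  have [b1 cmb] := @step b 3 b0 mb.
  have hs := Rmult_le_compat_r _ _ _ mb0 h3.
  split; first by apply: pos; lra.
  rewrite (_ : 7 * 3 * PI / 12 = 7 * PI / 4); last by field.
  by apply: sin_7PI4_sub; [lra | nra | nra].
- have [] := @half_step_bounds c 6 ltac:(lra) ltac:(lra) ltac:(lra).
  move: (6 * t / 2) => b b0 mb.
  have mb0 : 0 <= INR m * b by apply: Rmult_le_pos; lra.
  have [b1 cmb] := @step b 6 b0 mb.
  have hs := Rmult_le_compat_r _ _ _ mb0 h6.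
  split; first by apply: pos; lra.
  rewrite (_ : 7 * 6 * PI / 12 = 7 * PI / 2); last by field.
  by apply: sin_7PI2_sub; [lra | nra | nra].
Qed.

Lemma angle_bounds x : - (7 * PI / 24) <= vertex_angle a N t x.
Proof.
have pi0 := PI_RGT_0; have zi := Rinv_0_lt_compat z z_gt0.
rewrite /vertex_angle -/z /t.
rewrite [X in _ <= X](_ : _ = 7 * PI / 6 * (INR (a x) * / z) - 7 * PI / 24);
  last by field; lra.
have : 0 <= INR (a x) * / z by apply: Rmult_le_pos; [exact: pos_INR | lra].
by nra.
Qed.

Lemma angle_upper x (c : R) : INR (a x) <= c * z ->
  vertex_angle a N t x <= 7 * PI / 6 * (c - 1 / 4).
Proof.
move=> ac; have pi0 := PI_RGT_0; have zi := Rinv_0_lt_compat z z_gt0.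
rewrite /vertex_angle -/z /t.
rewrite [X in X <= _](_ : _ = 7 * PI / 6 * (INR (a x) * / z - 1 / 4));
  last by field; lra.
have : INR (a x) * / z <= c.
  by apply: (Rmult_le_reg_r z) => //; rewrite Rmult_assoc Rinv_l; lra.
by nra.
Qed.

Lemma gain_vertex x :
  (2 * a x <= N)%N -> 997 / 1000 <= gain (cos (vertex_angle a N t x)).
Proof.
move=> /leP/le_INR; rewrite mult_INR /= => ax; have pi0 := PI_RGT_0.
apply: gain_main; split; last exact: (proj2 (COS_bound _)).
apply: Rle_trans cos_7PI24_ge _; apply: cos_ge_cos; first lra.
split; first exact: angle_bounds.
by have := @angle_upper x (1 / 2) ltac:(rewrite /z; lra); lra.
Qed.

Lemma gain_vertex_outlier x : (39 < m)%N -> (2 * a x <= N + 3 * m)%N ->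
  - (34 / 100) <= gain (cos (vertex_angle a N t x)).
Proof.
move=> m40 /leP/le_INR; rewrite mult_INR plus_INR mult_INR /= => ax.
have pi0 := PI_RGT_0.
have n40 : 40 <= INR m by have := le_INR _ _ (leP m40); rewrite /=; lra.
apply: gain_outlier; split; last exact: (proj2 (COS_bound _)).
apply: Rle_trans cos_3PI8_ge _; apply: cos_ge_cos; first lra.
split; first by have := angle_bounds x; lra.
(* The bound [N/2 + 3m/2 <= 4(N + 1)/7] amounts to [m^2 - 39 m + 16 >= 0]; the factor 4/7 turns into
   the angle [3 pi / 8]. *)
have h : INR (a x) <= 4 / 7 * z by move: zE; rewrite /z; nra.
have := @angle_upper x (4 / 7) h; lra.
Qed.

Lemma gain_total s2 s3 s6 P z2 z3 z6 Q c :
  missing_bounded s2 s3 s6 P -> adjacent_bounded z2 z3 z6 Q ->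
  0 <= P -> 0 <= s2 -> 0 <= s3 -> 0 <= s6 ->
  0 <= Q -> 0 <= z2 -> 0 <= z3 -> 0 <= z6 -> 40 <= c <= INR m + 3 ->
  22 * (s2 + z2) <= 1486 / 1000 * c -> 11 * (s3 + z3) <= 707 / 1000 * c ->
  22 * (s6 + z6) <= 9997 / 10000 * c ->
  \rsum_(x in A) gain (cos (vertex_angle a N t x)) <= 2072 / 100 + INR m * (P + Q).
Proof.
move=> miss adj P0 s20 s30 s60 Q0 z20 z30 z60 cm h2 h3 h6.
have [M sM idM] := pair_sum_identity e_sym aA (erefl N) cardA card_adj.
apply: (gain_sum idM sM card_adj miss adj) => // k s.
by apply: (freq_ok cm) => //; lra.
Qed.

(** Every vertex gains at least 0.997, while the total is at most [20.72 + 0.454 m]; this is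
    impossible from [m = 37] on. *)
Lemma almost_sidon_low : ~ {in A, forall x, (2 * a x <= N)%N}.
Proof.
move=> lo; have := @gain_total _ _ _ _ _ _ _ _ 40 missing_bound_low adjacent_bound_low.
do 9 (move=> /(_ ltac:(lra))); do 3 (move=> /(_ ltac:(lra))).
have : INR m.+1 * (997 / 1000) <= \rsum_(x in A) gain (cos (vertex_angle a N t x)).
  rewrite -cardA -sum1_card sum1_count -rsum_const; apply: rsum_le => x xA.
  exact/gain_vertex/lo.
by rewrite S_INR; lra.
Qed.

Lemma almost_sidon_outliers : (39 < m)%N ->
  {in A, forall x, (2 * a x <= N + 3 * m)%N} ->
  (2 < #|[set x in A | (N < 2 * a x)%N]|)%N.
Proof.
move=> m40 hi; rewrite ltnNge; apply/negP => few.
have n40 : 40 <= INR m by have := le_INR _ _ (leP m40); rewrite /=; lra.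
have := @gain_total _ _ _ _ _ _ _ _ 43 missing_bound_high adjacent_bound_high.
do 9 (move=> /(_ ltac:(lra))); do 3 (move=> /(_ ltac:(lra))).
set out := [set x in A | _] in few.
(* An outlier loses [1.337 = 0.997 + 0.34] against an ordinary vertex. With at most two outliers the
   total still exceeds [20.72 + 0.42 m]. *)
have : INR m.+1 * (997 / 1000) + INR #|out| * - (1337 / 1000) <=
    \rsum_(x in A) gain (cos (vertex_angle a N t x)).
  rewrite -cardA -!sum1_card !sum1_count -!rsum_const.
  rewrite [X in _ + X](eq_bigl (fun x => (x \in A) && (N < 2 * a x)%N)); last first.
    by move=> x; rewrite inE.
  rewrite big_mkcondr -big_split /=; apply: rsum_le => x xA.
  case: ltnP => ax; last by have := gain_vertex ax; lra.
  by have := gain_vertex_outlier m40 (hi x xA); lra.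
have := le_INR _ _ (leP few); rewrite !S_INR /=.
by lra.
Qed.

End AlmostSidon.

Local Close Scope R_scope.
(** * Upper bound on the order *)

Section RimAdj.
Variable m : nat.
Hypothesis m_ge4 : 3 < m.
Implicit Types (i : 'I_m) (A : {set option 'I_m}).

(** The hub has no rim neighbour, and each other vertex has at most two. *)
Lemma card_rim_adj_pairs A : None \in A ->
  #|adj_pairs (@rim_adj m) A| <= 2 * #|A|.-1.
Proof.
move=> A0; apply: leq_trans (_ : #|[set p in setX A A | rim_adj p.1 p.2]| <= _).
  by apply/subset_leq_card/subsetP => p; rewrite !inE => /and3P[-> _ ->].
rewrite -sum1_card.
rewrite (eq_bigl (fun p => (p.1 \in A) && ((p.2 \in A) && rim_adj p.1 p.2))).
  rewrite -(pair_big_dep (mem A) (fun x y => (y \in A) && rim_adj x y)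
    (fun _ _ => 1)) /=.
  rewrite (bigD1 None) //= big_pred0 ?add0n; last by move=> y; rewrite andbF.
  rewrite (cardsD1 None A) A0 /= mulnC -sum_nat_const.
  rewrite (eq_bigl (mem (A :\ None))); last by move=> x; rewrite !inE andbC.
  apply: leq_sum => -[i|]; last by rewrite !inE.
  move=> _; apply: leq_trans (card_rim_adj i); rewrite -sum1_card.
  rewrite big_mkcond [X in _ <= X]big_mkcond; apply: leq_sum => y _.
  by case: (y \in A) => //=; case: ifP.
by move=> p; rewrite !inE andbA.
Qed.

Definition rim_ball i : {set option 'I_m} :=
  Some i |: [set Some (ordS i); Some (ord_pred i)].

Lemma rim_ballP i x : reflect (x = Some i \/ rim_adj (Some i) x) (x \in rim_ball i).
Proof.
have e j : (ord_pred i == j) = (ordS j == i).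
  by apply/eqP/eqP => [<-|<-]; rewrite ?ord_predK ?ordSK.
rewrite !inE; case: x => [j|] /=; last by right; case.
rewrite ![Some _ == _](inj_eq (@Some_inj _)) ![j == _]eq_sym e.
by apply: (iffP orP) => -[]; auto; [move=> /eqP->|case=> ->; rewrite eqxx]; auto.
Qed.

Lemma card_rim_ball i : #|rim_ball i| = 3.
Proof.
rewrite -(ord_predK i); move: (ord_pred i) => j.
rewrite /rim_ball ordSK cardsU1 cards2 !inE.
rewrite ![Some _ == _](inj_eq (@Some_inj _)) (negPf (ordS_neq m_ge4 _)).
by rewrite ![_ == j]eq_sym (negPf (ordS_neq m_ge4 _)) (negPf (ordS2_neq m_ge4 _)).
Qed.

End RimAdj.

Lemma leech_wheel_large m : 39 < m -> ~ geodesic_leech (wheel m.+1).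
Proof.
move=> m40; have m4 : 3 < m by lia.
case/(leech_almost_sidon m4) => a a0; set N := _./2 => -[sm inj].
case: (boolP [exists x, N + 3 * m < 2 * a x]) => [/existsP[[i|]]|].
- move=> hi; pose A := ~: rim_ball i.
  have cA : #|A| = (m - 3).+1.
    have := cardsC (rim_ball i); rewrite card_rim_ball // -/A card_option card_ord.
    by lia.
  (* Lowering [m] by 3 lowers [N] by exactly [3m]. This fixes the threshold: a far partner [y] of
     [i] has [2 a y <= 2N - 2 a i < N - 3m]. *)
  have NE : ((m - 3) * (m - 3 + 3))./2 = N - 3 * m by rewrite /N; nia.
  have lo : {in A, forall y, 2 * a y <= N - 3 * m}.
    move=> y; rewrite inE => /rim_ballP h.
    have ny : Some i != y by apply/eqP => e; apply: h; left.
    have na : ~~ rim_adj (Some i) y by apply/negP => ?; apply: h; right.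
    by have := sm (Some i) y (in_setT _) (in_setT _) ny na; lia.
  have A0 : None \in A by rewrite !inE.
  apply: (almost_sidon_low (a := a) (@rim_adjC m) _ cA); rewrite ?NE //; first by lia.
    split=> [x y xA yA xy nxy|x y _ _ x' y' _ _]; last by apply: inj; rewrite inE.
    have := lo x xA; have := lo y yA.
    by have := sm x y (in_setT _) (in_setT _) xy nxy; lia.
  by have := card_rim_adj_pairs A0; rewrite cA.
- by rewrite a0; lia.
- rewrite negb_exists => /forallP hi.
  have : 2 < #|[set x in [set: option 'I_m] | N < 2 * a x]|.
    apply: (almost_sidon_outliers (m := m) (@rim_adjC m)) => //.
    + by lia.
    + by rewrite cardsT card_option card_ord.
    + have := @card_rim_adj_pairs m setT (in_setT _).
      by rewrite cardsT card_option card_ord.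
    + by move=> x _; have := hi x; rewrite -leqNgt.
  set O := [set x in _ | _] => O2.
  (* Two far outliers would have a sum above [N], so outliers are pairwise rim neighbours. Three of
     them would form a triangle on the rim, but the ends of a rim ball are not adjacent. *)
  have adjO : {in O &, forall x y, x != y -> rim_adj x y}.
    move=> x y; rewrite !inE /= => xO yO xy; apply/negPn/negP => nxy.
    by have := sm x y (in_setT _) (in_setT _) xy nxy; lia.
  have /set0Pn[[i|] iO] : O != set0 by rewrite -card_gt0; lia.
    have OE : O = rim_ball i.
      apply/eqP; rewrite eqEcard card_rim_ball // O2 andbT.
      apply/subsetP => y yO; apply/rim_ballP.
      have [->|ny] := eqVneq y (Some i); first by left.
      by right; apply: adjO; rewrite // eq_sym.
    move: OE; rewrite -(ord_predK i); move: (ord_pred i) => j.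
    rewrite /rim_ball ordSK => OE.
    have : rim_adj (Some (ordS (ordS j))) (Some j).
      apply: adjO; rewrite ?OE ?inE ?eqxx ?orbT //.
      by rewrite (inj_eq (@Some_inj _)) eq_sym (ordS2_neq m4).
    rewrite /rim_adj [_ == j]eq_sym (negPf (ordS3_neq m4 _)).
    by rewrite (inj_eq (@ordS_inj m)) (negPf (ordS_neq m4 _)).
  by rewrite !inE a0 in iO.
Qed.

Lemma leech_wheel_upper n : leech_wheel_orders n -> 5 <= n <= 40.
Proof.
move=> [n5 gl]; rewrite n5 /= leqNgt; apply/negP => n40.
by case: n n5 n40 gl => // m _ m39; apply: leech_wheel_large.
Qed.

Theorem corollary1p2 :
  (forall n : nat, 5 <= n <= 13 -> leech_wheel_orders n) /\
  (forall n : nat, leech_wheel_orders n -> 5 <= n <= 40).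
Proof.
by split=> n; [apply: leech_wheel_small | apply: leech_wheel_upper].
Qed.
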